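(* Let $k$ be a field, $A=k[x,y]$ the polynomial ring in two variables, and let $a,b\in A$ satisfy $A/aA\cong k[t,t^{-1}]$ (Laurent polynomial ring in one variable), $A/bA\cong k[t]$, and $A/(aA+bA)\cong k$. Let $B=A[b/a]\subset A_a$. Then: (a) $B$ is a UFD and $B^*=k^*$; (b) if $k$ is algebraically closed, then $X=\mathrm{Spec}(B)$ is a smooth affine factorial surface over $k$ with trivial units (i.e. $\mathcal{O}(X)^*=k^*$).
   Context: $A_a$ denotes the localization of $A$ at the element $a$, and $A[b/a]$ is the subring of $A_a$ generated by $A$ and $b/a$. *)

(* Defs.v *)
From HB Require Import structures.
From mathcomp Require Import all_boot all_order all_algebra.
From mathcomp Require Import boolp.
Set Implicit Arguments. Unset Strict Implicit. Unset Printing Implicit Defensive.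
Import Order.TTheory GRing.Theory.
Local Open Scope ring_scope.
Notation "x %:F" := (@tofrac _ x) (format "x %:F") : ring_scope.

Section Generic.
Variable R : comNzRingType.

Definition is_unit (x : R) : Prop := exists y : R, x * y = 1.

Definition irreducible_elt (x : R) : Prop :=
  x != 0 /\ ~ is_unit x /\ forall y z : R, x = y * z -> is_unit y \/ is_unit z.

Definition associated (x y : R) : Prop := exists u : R, is_unit u /\ x = u * y.

Definition UFD : Prop :=
  [/\ forall x y : R, x * y = 0 -> x = 0 \/ y = 0,
      forall x : R, x != 0 -> ~ is_unit x ->
        exists s : seq R, (forall y, y \in s -> irreducible_elt y) /\
                          x = \prod_(y <- s) y
    & forall s t : seq R,
        (forall y, y \in s -> irreducible_elt y) ->
        (forall y, y \in t -> irreducible_elt y) ->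
        \prod_(y <- s) y = \prod_(y <- t) y ->
        exists t' : seq R, perm_eq t t' /\ size s = size t' /\
          forall i, (i < size s)%N -> associated (nth 0 s i) (nth 0 t' i)].

Definition is_ideal (I : R -> Prop) : Prop :=
  [/\ I 0, forall x y, I x -> I y -> I (x + y) & forall r x, I x -> I (r * x)].

Definition is_prime_ideal (I : R -> Prop) : Prop :=
  [/\ is_ideal I, ~ I 1 & forall x y, I (x * y) -> I x \/ I y].

Definition prime_chain (n : nat) (P : nat -> R -> Prop) : Prop :=
  (forall i, (i <= n)%N -> is_prime_ideal (P i)) /\
  (forall i, (i < n)%N ->
     (forall x, P i x -> P i.+1 x) /\ exists x, P i.+1 x /\ ~ P i x).

Definition krull_dim_eq (n : nat) : Prop :=
  (exists P, prime_chain n P) /\ ~ (exists P, prime_chain n.+1 P).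

Variables (k : fieldType) (iota : k -> R).

Definition finite_type_over : Prop :=
  exists s : seq R, forall S : R -> Prop,
    (forall c, S (iota c)) -> (forall x, x \in s -> S x) ->
    (forall x y, S x -> S y -> S (x + y)) ->
    (forall x y, S x -> S y -> S (x * y)) -> forall x, S x.

Definition kalg_point (phi : R -> k) : Prop :=
  [/\ forall x y, phi (x + y) = phi x + phi y,
      forall x y, phi (x * y) = phi x * phi y,
      phi 1 = 1 & forall c, phi (iota c) = c].

Definition point_derivation (phi : R -> k) (D : R -> k) : Prop :=
  [/\ forall x y, D (x + y) = D x + D y,
      forall c x, D (iota c * x) = c * D x
    & forall x y, D (x * y) = phi x * D y + phi y * D x].

Definition tangent_dim_eq (phi : R -> k) (n : nat) : Prop :=
  exists Ds : 'I_n -> R -> k,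
    [/\ forall i, point_derivation phi (Ds i),
        forall D, point_derivation phi D ->
          exists c : 'I_n -> k, forall x, D x = \sum_(i < n) c i * Ds i x
      & forall c : 'I_n -> k, (forall x, \sum_(i < n) c i * Ds i x = 0) ->
          forall i, c i = 0].

(* Spec R is a smooth affine surface over the algebraically closed field k: *)
(* R is of finite type over k, has Krull dimension 2, and is regular at     *)
(* every closed point (= k-point, by the Nullstellensatz), i.e. the tangent *)
(* space there has dimension 2.                                             *)
Definition smooth_affine_surface : Prop :=
  [/\ finite_type_over, krull_dim_eq 2 &
      forall phi, kalg_point phi -> tangent_dim_eq phi 2].

End Generic.

(* A = k[x,y] is modelled as {poly {poly k}}.  B = A[b/a] inside A_a, which *)
(* sits inside Frac(A) = {fraction A}.                                       *)
Notation poly2 k := {poly {poly k}}.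

Section Blowup.
Variables (k : fieldType) (a b : poly2 k).

Definition Bpred : pred {fraction poly2 k} :=
  fun x => `[< exists p : {poly poly2 k},
               x = (map_poly (@tofrac _) p).[b%:F / a%:F] >].

Lemma Bpred_subring : subring_closed Bpred.
Proof.
split.
- apply/asboolP; exists 1; by rewrite rmorph1 hornerC.
- move=> x y /asboolP [p ->] /asboolP [q ->]; apply/asboolP; exists (p - q).
  by rewrite rmorphB hornerD hornerN.
- move=> x y /asboolP [p ->] /asboolP [q ->]; apply/asboolP; exists (p * q).
  by rewrite rmorphM hornerM.
Qed.

HB.instance Definition _ := GRing.isSubringClosed.Build _ Bpred Bpred_subring.

Record Bring := MkB { Bval : {fraction poly2 k}; _ : Bval \in Bpred }.

HB.instance Definition _ := [isSub for Bval].
HB.instance Definition _ := [Choice of Bring by <:].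
HB.instance Definition _ := [SubChoice_isSubComNzRing of Bring by <:].

Lemma constB_in (c : k) : (c%:P%:P : poly2 k)%:F \in Bpred.
Proof.
apply/asboolP; exists ((c%:P%:P : poly2 k)%:P).
by rewrite map_polyC hornerC.
Qed.

Definition constB (c : k) : Bring := MkB (constB_in c).

End Blowup.

(* Main.v *)
(* The subring [B] is [A[z]/(az - b)]: pseudo-division by [az - b] followed by *)
(* cancellation of powers of the prime [a], which does not divide [b].         *)
(* Hence [B/aB = (A/(a,b))[z] = k[z]], so [a] stays prime in [B], while        *)
(* [B_a = A_a].  As in Nagata's criterion, a prime [p] of [A] not associated   *)
(* to [a] is [a^n q] in [B] with [q] prime or a unit, provided that the        *)
(* powers of [a] dividing [p] in [B] are bounded; this holds because           *)
(* [a^n | p] in [B] forces [p] to vanish to order at least [n] at the point    *)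
(* [a = b = 0], as seen in a chart of the blowup of that point.  Units of [B]  *)
(* are units of [A_a], i.e. [c a^n], and [a] is not a unit of [B].             *)
(* For the dimension, [0 < aB < (a, b/a)] is a chain of primes, and a longer   *)
(* one is excluded since any three elements of [B] are algebraically           *)
(* dependent over [k].  For smoothness, the gradient of [az - b] vanishes      *)
(* nowhere on [az = b], because [a] and [b] generate a maximal ideal of [A].   *)

(* The hypotheses enter through two facts: [a] is prime in [A] ([laurent_quotient_prime]), and
   [(a, b)] is the maximal ideal of a rational point while [a] does not divide [b]
   ([laurent_quotient_ndivides]). They make [B] the hypersurface ring [A[z]/(az - b)] ([presB_eq0])
   with [B/aB = k[z]] ([divides_a_presB]).

   A domain whose nonzero elements factor into primes is a UFD ([factorial_UFD]). Gauss's lemma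
   gives such factorizations in [A] ([poly2_factorial]), and [factors_inclB_prime] carries them to
   [B] ([B_factorial]). The delicate point is that no nonzero element of [A] is divisible in [B] by
   all powers of [a] ([divides_aX_bounded]): since [a] and [b] generate the whole maximal ideal, [a]
   vanishes to order exactly one at the point ([chart_a]). Primality of [a] in [B] also gives the
   units ([B_units]).

   For (b), algebraic dependence ([B_dependence]) bounds chains of primes ([no_prime_chain3]), and
   the tangent space at a point is the orthogonal complement in [k^3] of the gradient of [az - b],
   which is nonzero ([gradient_neq0]). *)
Require Import Defs.
From HB Require Import structures.
From mathcomp Require Import all_boot all_order all_algebra.
From mathcomp Require Import boolp ring zify.
Import GRing.Theory.
Local Open Scope ring_scope.
Set Implicit Arguments. Unset Strict Implicit. Unset Printing Implicit Defensive.

(** * Prime factorizations in a commutative domain *)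

Section Divisibility.
Variable R : comNzRingType.
Hypothesis R_domain : forall x y : R, x * y = 0 -> x = 0 \/ y = 0.

Definition divides (x y : R) : Prop := exists z, y = z * x.

Definition prime_elt (p : R) : Prop :=
  [/\ p != 0, ~ is_unit p
    & forall x y, divides p (x * y) -> divides p x \/ divides p y].

(** Prime factors, not irreducible ones: uniqueness then follows from existence, and the property
    passes to products and to divisors. *)
Definition factors (x : R) : Prop :=
  exists u s, [/\ is_unit u, forall p, p \in s -> prime_elt p
                & x = u * \prod_(p <- s) p].

Definition factorial_ring : Prop := forall x, x != 0 -> factors x.

Lemma mulfI_domain (x y z : R) : x != 0 -> x * y = x * z -> y = z.
Proof.
move=> /eqP nzx e; have /R_domain[] : x * (y - z) = 0 by rewrite mulrBr e subrr.
  by [].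
by move/eqP; rewrite subr_eq0 => /eqP.
Qed.

Lemma mul_neq0_domain (x y : R) : x != 0 -> y != 0 -> x * y != 0.
Proof. by move=> /eqP nzx /eqP nzy; apply/eqP => /R_domain[]. Qed.

Lemma exp_neq0_domain (x : R) n : x != 0 -> x ^+ n != 0.
Proof.
move=> nzx; elim: n => [|n IHn]; first by rewrite expr0 oner_neq0.
by rewrite exprS mul_neq0_domain.
Qed.

Lemma dividesMl (x y z : R) : divides x y -> divides x (z * y).
Proof. by case=> w ->; exists (z * w); rewrite mulrA. Qed.

Lemma dividesMr (x y z : R) : divides x y -> divides x (y * z).
Proof. by rewrite mulrC; apply: dividesMl. Qed.

Lemma dividesD (x y z : R) : divides x y -> divides x z -> divides x (y + z).
Proof. by case=> v -> [w ->]; exists (v + w); rewrite mulrDl. Qed.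

Lemma dividesN (x y : R) : divides x y -> divides x (- y).
Proof. by case=> v ->; exists (- v); rewrite mulNr. Qed.

Lemma divides_addl (x y z : R) : divides x (y + z) -> divides x z -> divides x y.
Proof.
by move=> yz /dividesN z'; rewrite -[y](addrK z); apply: dividesD.
Qed.

Lemma divides_unit (x u : R) : is_unit u -> divides x u -> is_unit x.
Proof. by case=> v uv [w e]; exists (w * v); rewrite -uv e; ring. Qed.

Lemma is_unit1 : is_unit (1 : R).
Proof. by exists 1; rewrite mulr1. Qed.

Lemma is_unitM (x y : R) : is_unit x -> is_unit y -> is_unit (x * y).
Proof. by case=> x' ex [y' ey]; exists (x' * y'); rewrite mulrACA ex ey mulr1. Qed.

Lemma is_unit_mull (x y : R) : is_unit (x * y) -> is_unit x.
Proof. by case=> z e; exists (y * z); rewrite mulrA. Qed.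

Lemma is_unit_mulr (x y : R) : is_unit (x * y) -> is_unit y.
Proof. by rewrite mulrC => /is_unit_mull. Qed.

Lemma prime_dividesX (p x : R) n : prime_elt p -> divides p (x ^+ n) -> divides p x.
Proof.
move=> [nzp Up pP]; elim: n => [|n IHn].
  by rewrite expr0 => /(divides_unit is_unit1).
by rewrite exprS => /pP[].
Qed.

Lemma factors_prod (s : seq R) :
  (forall x, x \in s -> factors x) -> factors (\prod_(x <- s) x).
Proof.
elim: s => [|x s IHs] Fs.
  by exists 1, [::]; split=> //; [exact: is_unit1 | rewrite !big_nil mulr1].
have [|u [r [Uu Pr ex]]] := Fs x; first by rewrite mem_head.
have [|v [t [Uv Pt es]]] := IHs.
  by move=> y ys; apply: Fs; rewrite inE ys orbT.
exists (u * v), (r ++ t); split; first exact: is_unitM.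
  by move=> p; rewrite mem_cat => /orP[/Pr|/Pt].
by rewrite big_cons es ex big_cat /=; ring.
Qed.

Lemma factors_unit (u : R) : is_unit u -> factors u.
Proof. by exists u, [::]; split=> //; rewrite big_nil mulr1. Qed.

Lemma factors_prime (p : R) : prime_elt p -> factors p.
Proof.
move=> Pp; exists 1, [:: p]; split; first exact: is_unit1.
  by move=> q; rewrite inE => /eqP->.
by rewrite big_seq1 mul1r.
Qed.

Lemma factorsM (x y : R) : factors x -> factors y -> factors (x * y).
Proof.
move=> Fx Fy; have := @factors_prod [:: x; y].
rewrite big_cons big_seq1; apply=> z.
by rewrite !inE => /orP[]/eqP->.
Qed.

(** Each prime of [x * y] divides [x] or [y] and can be cancelled there; once none is left, [x] is a
    unit. *)
Lemma factors_divisor (x y : R) : x * y != 0 -> factors (x * y) -> factors x.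
Proof.
move=> nz [u [s [Uu Ps e]]].
elim: s x y e Ps {nz} => [|p s IHs] x y.
  rewrite big_nil mulr1 => e _; apply: factors_unit.
  by apply: (@is_unit_mull x y); rewrite e.
rewrite big_cons => e Ps.
have Pp : prime_elt p by apply: Ps; rewrite mem_head.
have Ps' q : q \in s -> prime_elt q by move=> qs; apply: Ps; rewrite inE qs orbT.
have [nzp _ pP] := Pp.
have [|[z ez]|[z ez]] := pP x y.
- by rewrite e; exists (u * \prod_(q <- s) q); ring.
- rewrite ez; apply: factorsM; last exact: factors_prime.
  apply: (IHs z y _ Ps'); apply: (mulfI_domain nzp).
  by transitivity (x * y); [rewrite ez | rewrite e]; ring.
- apply: (IHs x z _ Ps'); apply: (mulfI_domain nzp).
  by transitivity (x * y); [rewrite ez | rewrite e]; ring.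
Qed.

(** If [p * m = r * g] with [p] prime not dividing [g], then [p] divides [r] and cancels; iterate
    over [s]. *)
Lemma cancel_primes (w g x : R) (s : seq R) :
  is_unit w -> (forall p, p \in s -> prime_elt p /\ ~ divides p g) ->
  divides g (w * \prod_(p <- s) p * x) -> divides g x.
Proof.
move=> [w' ew]; elim: s => [|p s IHs] Ps.
  rewrite big_nil mulr1 => -[r e]; exists (w' * r).
  by rewrite -mulrA -e mulrA [w' * w]mulrC ew mul1r.
rewrite big_cons => -[r e].
have [[nzp _ pP] ng] : prime_elt p /\ ~ divides p g by apply: Ps; rewrite mem_head.
have [|[z ez]|//] := pP r g; first by rewrite -e; exists (w * \prod_(q <- s) q * x); ring.
apply: IHs => [q qs|]; first by apply: Ps; rewrite inE qs orbT.
exists z; apply: (mulfI_domain nzp); transitivity (r * g); last by rewrite ez; ring.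
by rewrite -e; ring.
Qed.

Lemma cancel_primeX (p g x : R) n :
  prime_elt p -> ~ divides p g -> divides g (p ^+ n * x) -> divides g x.
Proof.
move=> Pp ng d; apply: (@cancel_primes 1 g x (nseq n p)); first exact: is_unit1.
  by move=> q /nseqP[->].
by rewrite mul1r big_nseq -Monoid.iteropE.
Qed.

Lemma divides_primeX_cancel (p c x : R) n :
  prime_elt p -> ~ divides p c -> divides (p ^+ n) (c * x) -> divides (p ^+ n) x.
Proof.
move=> [nzp _ pP] nc; elim: n x => [|n IHn] x; first by exists x; rewrite mulr1.
rewrite exprS => -[y e].
have [|//|[z ez]] := pP c x; first by exists (y * p ^+ n); rewrite e; ring.
have [|w ew] := IHn z; last by exists w; rewrite ez ew; ring.
exists y; apply: (mulfI_domain nzp); transitivity (c * x); first by rewrite ez; ring.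
by rewrite e; ring.
Qed.

Lemma prime_irreducible (p : R) : prime_elt p -> irreducible_elt p.
Proof.
move=> [nzp Up pP]; split=> //; split=> // y z e.
have [|[x ex]|[x ex]] := pP y z; first by exists 1; rewrite mul1r.
- right; exists x; apply: (mulfI_domain nzp).
  by transitivity (y * z); [rewrite ex; ring | rewrite -e mulr1].
- left; exists x; apply: (mulfI_domain nzp).
  by transitivity (y * z); [rewrite ex; ring | rewrite -e mulr1].
Qed.

Lemma prime_divides_prod (p w : R) (t : seq R) :
  prime_elt p -> is_unit w -> (forall q, q \in t -> irreducible_elt q) ->
  divides p (w * \prod_(q <- t) q) ->
  exists q v, [/\ q \in t, is_unit v & q = p * v].
Proof.
move=> [nzp Up pP] Uw It /pP[/(divides_unit Uw)//|].
elim: t It => [_|q t IHt It].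
  by rewrite big_nil => /(divides_unit is_unit1).
rewrite big_cons => /pP[[v e]|d].
  have [_ [_ /(_ _ _ e)[Uv|//]]] := It q (mem_head _ _).
  by exists q, v; split=> //; [rewrite mem_head | rewrite mulrC].
have [|r [v [rt Uv er]]] := IHt _ d.
  by move=> r rt; apply: It; rewrite inE rt orbT.
by exists r, v; split=> //; rewrite inE rt orbT.
Qed.

Lemma irreducible_prime (x : R) : factors x -> irreducible_elt x -> prime_elt x.
Proof.
move=> [u [[|p s] [Uu Ps e]]] [nzx [Ux xP]].
  by case: Ux; rewrite e big_nil mulr1.
have Pp : prime_elt p by apply: Ps; rewrite mem_head.
have [nzp Up pP] := Pp.
have [|//|[v ev]] := xP p (u * \prod_(q <- s) q).
  by rewrite e big_cons; ring.
have ex : x = p * (u * \prod_(q <- s) q) by rewrite e big_cons; ring.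
have xp y : divides p y -> divides x y.
  case=> z ->; exists (z * v); transitivity (z * p * 1); first by rewrite mulr1.
  by rewrite -[X in _ * X = _]ev ex; ring.
have px y : divides x y -> divides p y.
  by case=> z ->; rewrite ex; exists (z * (u * \prod_(q <- s) q)); ring.
by split=> // y z /px/pP[/xp|/xp]; [left | right].
Qed.

(** The unit [w] collects the discrepancies between matched associates during the induction. *)
Lemma prime_factorization_unique (s t : seq R) (w : R) :
  is_unit w -> (forall p, p \in s -> prime_elt p) ->
  (forall q, q \in t -> irreducible_elt q) ->
  \prod_(p <- s) p = w * \prod_(q <- t) q ->
  exists t', [/\ perm_eq t t', size s = size t' &
    forall i, (i < size s)%N -> associated (nth 0 s i) (nth 0 t' i)].
Proof.
elim: s t w => [|p s IHs] t w Uw Ps It.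
  rewrite big_nil; case: t It => [|q t] It e; first by exists [::].
  have [_ [[]]] := It q (mem_head _ _).
  apply: (@is_unit_mull _ (w * \prod_(r <- t) r)); exists 1.
  by rewrite mulr1 mulrCA [RHS]e big_cons.
rewrite big_cons => e.
have Pp : prime_elt p by apply: Ps; rewrite mem_head.
have nzp : p != 0 by case: Pp.
have [|q [v [qt [v' ev] eq]]] := prime_divides_prod Pp Uw It.
  by rewrite -e; exists (\prod_(r <- s) r); rewrite mulrC.
have [||||t' [tt' st' tP]] := IHs (rem q t) (w * v).
- by apply: is_unitM => //; exists v'.
- by move=> r rs; apply: Ps; rewrite inE rs orbT.
- by move=> r /mem_rem; apply: It.
- apply: (mulfI_domain nzp).
  rewrite e (perm_big _ (perm_to_rem qt)) /= big_cons eq; ring.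
exists (q :: t'); split.
- by rewrite (permPl (perm_to_rem qt)) perm_cons.
- by rewrite /= st'.
case=> [_|i ilt]; last exact: tP.
exists v'; split; first by exists v; rewrite mulrC.
by rewrite /= eq mulrCA [v' * v]mulrC ev mulr1.
Qed.

Theorem factorial_UFD : factorial_ring -> UFD R.
Proof.
move=> FR; split=> //.
- move=> x /FR[u [[|p s] [Uu Ps e]]] Ux.
    by case: Ux; rewrite e big_nil mulr1.
  (* [UFD] asks for a product with no unit in front, so the unit is absorbed into the first
     prime. *)
  exists (u * p :: s); split; last by rewrite big_cons e big_cons mulrA.
  have [nzp [Up pP]] : irreducible_elt p.
    by apply: prime_irreducible; apply: Ps; rewrite mem_head.
  move=> y; rewrite inE => /orP[/eqP->|ys]; last first.
    by apply: prime_irreducible; apply: Ps; rewrite inE ys orbT.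
  have [u' eu] := Uu.
  have pE (z : R) : p * z = u' * (u * p * z).
    by rewrite -[LHS]mul1r -eu; ring.
  split; first by apply: contra_neq nzp => e'; rewrite -[p]mulr1 pE mulr1 e' mulr0.
  split=> [/is_unit_mulr//|y' z' e'].
  have [|/is_unit_mulr|] := pP (u' * y') z'; [|by left|by right].
  by rewrite -[p]mulr1 pE mulr1 e' mulrA.
- move=> s t Is It e.
  have [||||t' [? ? ?]] := @prime_factorization_unique s t 1; last by exists t'.
  + exact: is_unit1.
  + move=> p /Is Ip; apply: irreducible_prime => //; apply: FR.
    by case: Ip.
  + by [].
  + by rewrite mul1r.
Qed.

End Divisibility.

(** * Gauss's lemma *)

Section PolyFactorial.

Lemma idomain_domain (R : idomainType) (x y : R) : x * y = 0 -> x = 0 \/ y = 0.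
Proof. by move/eqP; rewrite mulf_eq0 => /orP[]/eqP; [left | right]. Qed.

Lemma divides_polyC (R : comNzRingType) (p : R) (f : {poly R}) :
  divides p%:P f <-> forall i, divides p f`_i.
Proof.
split=> [[g ->] i|]; first by exists g`_i; rewrite coefMC.
move=> /choice[c cP]; exists (\poly_(i < size f) c i).
apply/polyP=> i; rewrite coefMC coef_poly; case: ltnP => [_|fi]; first exact: cP.
by rewrite mul0r nth_default.
Qed.

(** Gauss's lemma: if [p] divides a product, it divides one of the two constant terms. Dropping that
    term leaves a product with a factor ['X], which cancels, and a double induction concludes. *)
Lemma prime_polyC (R : idomainType) (p : R) : prime_elt p -> prime_elt p%:P.
Proof.
move=> [nzp Up pP]; split; first by rewrite polyC_eq0.
  move=> [q e]; case: Up; exists q`_0.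
  by rewrite -coefCM e coefC eqxx.
have shift (f g : {poly R}) c :
    divides p%:P (f * 'X + c%:P) <-> divides p%:P f /\ divides p c.
  split=> [/divides_polyC d|[[f' ->] [c' ->]]].
    split; last by have := d 0%N; rewrite coefD coefMX coefC add0r.
    by apply/divides_polyC => i; have := d i.+1; rewrite coefD coefMX coefC addr0.
  by exists (f' * 'X + c'%:P); rewrite polyCM; ring.
elim/poly_ind=> [|f c IHf] g; first by left; exists 0; rewrite mul0r.
elim/poly_ind: g => [|g d IHg] dv; first by right; exists 0; rewrite mul0r.
have [|pc|pd] := pP c d.
- move/divides_polyC/(_ 0%N): dv.
  by rewrite coef0M !coefD !coefMX !coefC !add0r.
- have [||?] := IHf (g * 'X + d%:P); [|by left; apply/shift|by right].
  have := dv; rewrite mulrDl => /divides_addl[|z ez].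
    by case: pc => c' ->; exists (c'%:P * (g * 'X + d%:P)); rewrite polyCM; ring.
  have /(shift _ 0)[]// : divides p%:P (f * (g * 'X + d%:P) * 'X + 0%:P).
  by exists z; rewrite -ez addr0; ring.
- have [||?] := IHg; [|by left|by right; apply/shift].
  have := dv; rewrite mulrDr => /divides_addl[|z ez].
    by case: pd => d' ->; exists (d'%:P * (f * 'X + c%:P)); rewrite polyCM; ring.
  have /(shift _ 0)[]// : divides p%:P ((f * 'X + c%:P) * g * 'X + 0%:P).
  by exists z; rewrite -ez addr0; ring.
Qed.

Lemma is_unit_polyC (R : idomainType) (f : {poly R}) :
  is_unit f -> exists c : R, is_unit c /\ f = c%:P.
Proof.
move=> [g e]; have : size (f * g) = 1%N by rewrite e size_poly1.
move=> sfg; have /andP[nzf nzg] : (f != 0) && (g != 0).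
  by rewrite -negb_or -mulf_eq0 e oner_eq0.
have sf : (size f <= 1)%N.
  move: sfg; rewrite size_mul //; move: nzf nzg; rewrite -!size_poly_gt0.
  by case: (size f) (size g) => [|[|m]] [|n] //=; rewrite addnS.
rewrite (size1_polyC sf) in e *; exists f`_0; split=> //.
by exists g`_0; rewrite -coefCM e coef1.
Qed.

Definition primitive_poly (R : idomainType) (f : {poly R}) : Prop :=
  forall p : R, prime_elt p -> ~ divides p%:P f.

(** Prime constants are pulled out of [f] one at a time; each removes a prime from the leading
    coefficient, so the process stops. *)
Lemma factorial_content (R : idomainType) (f : {poly R}) :
  factorial_ring R -> f != 0 -> exists c g, f = c%:P * g /\ primitive_poly g.
Proof.
move=> FR nzf; have [|u [s [Uu Ps e]]] := FR (lead_coef f).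
  by rewrite lead_coef_eq0.
have [n] := ubnP (size s); elim: n f s u nzf e Uu Ps => // n IHn f s u nzf e Uu Ps lsn.
have [prim|/existsNP[p /not_implyP[Pp /contrapT[g eg]]]] := pselect (primitive_poly f).
  by exists 1, f; rewrite mul1r.
have nzp : p != 0 by case: Pp.
have elc : lead_coef f = lead_coef g * p by rewrite eg lead_coefM lead_coefC.
have [| |q [v [qs Uv eq]]] := @prime_divides_prod _ p u s Pp Uu.
- by move=> q /Ps; apply: prime_irreducible; apply: idomain_domain.
- by rewrite -e elc; exists (lead_coef g).
have [||||| c [h [eh hP]]] := IHn g (rem q s) (u * v).
- by apply: contraNneq nzf => g0; rewrite eg g0 mul0r.
- apply: (mulIf nzp); rewrite -elc e (perm_big _ (perm_to_rem qs)) /= big_cons eq.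
  by ring.
- exact: is_unitM.
- by move=> r /mem_rem/Ps.
- rewrite size_rem //; case: (s) qs lsn => //= r s' _; by rewrite ltnS.
by exists (p * c), h; rewrite eg eh polyCM; split=> //; ring.
Qed.

(** Here [%|] is divisibility over the fraction field, that is, up to a nonzero scalar; the primes
    of that scalar cancel because none divides [g]. *)
Lemma primitive_divides (R : idomainType) (g x : {poly R}) :
  factorial_ring R -> primitive_poly g -> g %| x -> divides g x.
Proof.
move=> FR prim /Pdiv.Idomain.dvdpP[[c q] /= nzc e].
have [u [s [Uu Ps ec]]] := FR _ nzc.
apply: (@cancel_primes _ (@idomain_domain _) u%:P _ _ [seq p%:P | p <- s]).
- by case: Uu => v ev; exists v%:P; rewrite -polyCM ev.
- by move=> _ /mapP[p /Ps Pp ->]; split; [exact: prime_polyC | exact: prim].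
- rewrite big_map -(rmorph_prod (@polyC R)) -polyCM -ec mul_polyC e.
  by exists q.
Qed.

Lemma primitive_irreducible_prime (R : idomainType) (g : {poly R}) :
  factorial_ring R -> primitive_poly g -> irreducible_poly g -> prime_elt g.
Proof.
move=> FR prim [sg irr]; split.
- by rewrite -size_poly_gt0 ltnW.
- by move=> /is_unit_polyC[c [_ eg]]; move: sg; rewrite eg ltnNge size_polyC_leq1.
- move=> x y d; have gxy : g %| x * y by case: d => z ->; rewrite Pdiv.Idomain.dvdp_mulIr.
  have [co|nco] := boolP (Pdiv.Idomain.coprimep g x).
    right; apply: primitive_divides => //.
    by rewrite -(Pdiv.Idomain.Gauss_dvdpr _ co).
  left; apply: primitive_divides => //.
  have := irr _ nco (Pdiv.Idomain.dvdp_gcdl _ _).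
  by rewrite /Pdiv.Idomain.eqp => /andP[_] /Pdiv.Idomain.dvdp_trans; apply; exact: Pdiv.Idomain.dvdp_gcdr.
Qed.

Theorem poly_factorial (R : idomainType) : factorial_ring R -> factorial_ring {poly R}.
Proof.
move=> FR f; have [n] := ubnP (size f); elim: n f => // n IHn f lfn nzf.
have FC (c : R) : c != 0 -> factors (c%:P : {poly R}).
  move=> /FR[u [s [[v ev] Ps ->]]]; exists u%:P, [seq p%:P | p <- s]; split.
  - by exists v%:P; rewrite -polyCM ev.
  - by move=> _ /mapP[p /Ps Pp ->]; apply: prime_polyC.
  - by rewrite polyCM big_map (rmorph_prod (@polyC R)).
have [/size1_polyC ef|sf] := leqP (size f) 1.
  by rewrite ef; apply: FC; rewrite -polyC_eq0 -ef.
have [irr|nirr] := pselect (irreducible_poly f).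
  have [c [g [ef prim]]] := factorial_content FR nzf.
  have nzc : c != 0 by apply: contra_neq nzf => c0; rewrite ef c0 mul0r.
  rewrite ef; apply: factorsM; first exact: FC.
  apply: factors_prime; apply: primitive_irreducible_prime => //.
  have fg : f %= g by rewrite ef mul_polyC Pdiv.Idomain.eqp_scale.
  split; first by rewrite -(Pdiv.Idomain.eqp_size fg).
  move=> q sq; rewrite -(Pdiv.Idomain.eqp_dvdr _ fg) => /(irr.2 _ sq) qf.
  exact: Pdiv.Idomain.eqp_trans qf fg.
have [q [sq qf nqf]] : exists q : {poly R}, [/\ size q != 1%N, q %| f & ~~ (q %= f)].
  apply: contrapT => H; apply: nirr; split=> // q sq qf.
  by apply: contrapT => /negP nqf; apply: H; exists q.
have /Pdiv.Idomain.dvdpP[[c r] /= nzc e] := qf.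
have nzrq : r * q != 0 by rewrite -e -mul_polyC mulf_eq0 polyC_eq0 negb_or nzc.
have [nzr nzq] : r != 0 /\ q != 0 by apply/andP; rewrite -negb_or -mulf_eq0.
have szf : size f = (size r + size q).-1 by rewrite -size_mul // -e size_scale.
have lqf : (size q < size f)%N.
  by rewrite ltn_neqAle Pdiv.Idomain.dvdp_size_eqp // nqf Pdiv.Idomain.dvdp_leq.
have lrf : (size r < size f)%N.
  move: sq nzq; rewrite -size_poly_gt0 szf; case: (size q) => [|[|m]] // _ _.
  by rewrite !addnS /= ltnS leq_addr.
(* The smaller polynomials [r] and [q] satisfy [c * f = r * q], so [f] inherits its factorization as
   a divisor of their product. *)
apply: (@factors_divisor _ (@idomain_domain _) f c%:P).
  by rewrite mulrC mul_polyC e.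
rewrite mulrC mul_polyC e; apply: factorsM.
- by apply: IHn => //; exact: leq_trans lrf _.
- by apply: IHn => //; exact: leq_trans lqf _.
Qed.

Lemma field_factorial (k : fieldType) : factorial_ring k.
Proof. by move=> x nzx; apply: factors_unit; exists x^-1; rewrite divff. Qed.

Lemma poly2_factorial (k : fieldType) : factorial_ring (poly2 k).
Proof. by apply: poly_factorial; apply: poly_factorial; exact: field_factorial. Qed.

End PolyFactorial.

(** * Evaluation homomorphisms and induction on iterated polynomials *)

Section PolyEval.

Variables (D R : comNzRingType) (h : {rmorphism D -> R}) (x : R).

Definition poly_eval (p : {poly D}) : R := (map_poly h p).[x].

HB.instance Definition _ :=
  GRing.RMorphism.copy poly_eval (horner_eval x \o map_poly h).

Lemma poly_evalC c : poly_eval c%:P = h c.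
Proof. by rewrite /poly_eval map_polyC hornerC. Qed.

Lemma poly_evalX : poly_eval 'X = x.
Proof. by rewrite /poly_eval map_polyX hornerX. Qed.

End PolyEval.

Section PolyInd.

Lemma poly_closed_ind (D : comNzRingType) (S : {poly D} -> Prop) :
  (forall c, S c%:P) -> S 'X -> (forall p q, S p -> S q -> S (p + q)) ->
  (forall p q, S p -> S q -> S (p * q)) -> forall p, S p.
Proof.
move=> SC SX SD SM; elim/poly_ind=> [|p c Sp]; first by rewrite -polyC0.
by apply: (SD) => //; apply: SM.
Qed.

Lemma poly2_closed_ind (k : fieldType) (S : poly2 k -> Prop) :
  (forall c, S c%:P%:P) -> S 'X%:P -> S 'X ->
  (forall p q, S p -> S q -> S (p + q)) ->
  (forall p q, S p -> S q -> S (p * q)) -> forall p, S p.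
Proof.
move=> SC SX SY SD SM; apply: poly_closed_ind => //.
apply: poly_closed_ind => // p q Sp Sq; first by rewrite polyCD; apply: SD.
by rewrite polyCM; apply: SM.
Qed.

Lemma poly3_closed_ind (k : fieldType) (S : {poly poly2 k} -> Prop) :
  (forall c, S c%:P%:P%:P) -> S 'X%:P%:P -> S 'X%:P -> S 'X ->
  (forall p q, S p -> S q -> S (p + q)) ->
  (forall p q, S p -> S q -> S (p * q)) -> forall p, S p.
Proof.
move=> SC SX SY SZ SD SM; apply: poly_closed_ind => //.
apply: poly2_closed_ind => // p q Sp Sq; first by rewrite polyCD; apply: SD.
by rewrite polyCM; apply: SM.
Qed.

End PolyInd.

(** * A chart of the blowup of a point of the plane *)

Section BlowupChart.
Variables (k : fieldType) (x0 y0 : k).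

Definition exc_div : poly2 k := ('X - x0%:P)%:P.
Local Notation T := exc_div.

(* The chart [(x, s) |-> (x, y0 + (x - x0) s)] of the blowup at [(x0, y0)]; *)
(* [T = 0] is its exceptional line.                                        *)
Definition chart (f : poly2 k) : poly2 k := f \Po (y0%:P%:P + T * 'X).

HB.instance Definition _ :=
  GRing.RMorphism.copy chart (comp_poly (y0%:P%:P + T * 'X)).

Definition restr_exc (f : poly2 k) : {poly k} := map_poly (horner_eval x0) f.

HB.instance Definition _ :=
  GRing.RMorphism.copy restr_exc (map_poly (horner_eval x0)).

Lemma restr_excC p : restr_exc p%:P = p.[x0]%:P.
Proof. exact: map_polyC. Qed.

Lemma restr_excX : restr_exc 'X = 'X.
Proof. exact: map_polyX. Qed.

Lemma chartC p : chart p%:P = p%:P.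
Proof. exact: comp_polyC. Qed.

Lemma chartX : chart 'X = y0%:P%:P + T * 'X.
Proof. exact: comp_polyX. Qed.

Lemma divides_XsubC (c : k) (p : {poly k}) : divides ('X - c%:P) p <-> p.[c] = 0.
Proof. by split=> [/factor_theorem/rootP|/rootP/factor_theorem]. Qed.

Lemma prime_XsubC (c : k) : prime_elt ('X - c%:P : {poly k}).
Proof.
split; first by rewrite polyXsubC_eq0.
- move=> [q /(congr1 (horner^~ c))].
  by rewrite !hornerE subrr mul0r => /esym/eqP; rewrite oner_eq0.
- move=> p q /divides_XsubC/eqP; rewrite hornerM mulf_eq0.
  by case/orP=> /eqP/divides_XsubC; [left | right].
Qed.

Lemma prime_exc_div : prime_elt T.
Proof. exact: prime_polyC (prime_XsubC x0). Qed.

Lemma divides_exc_div f : divides T f <-> restr_exc f = 0.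
Proof.
split=> [[g ->]|/polyP f0].
  by rewrite rmorphM /= [restr_exc T]restr_excC !hornerE subrr mulr0.
apply/divides_polyC => i; apply/divides_XsubC.
by have := f0 i; rewrite coef_map coef0.
Qed.

Lemma chart_exc_div : chart T = T.
Proof. exact: comp_polyC. Qed.

Lemma chart_Y : chart ('X - y0%:P%:P) = T * 'X.
Proof. by rewrite rmorphB /= chartX chartC addrC addKr. Qed.

Lemma chart_eq0 f : chart f = 0 -> f = 0.
Proof.
move/eqP; rewrite comp_poly_eq0 => [/eqP//|].
have nzT : T != 0 by case: prime_exc_div.
by rewrite addrC size_MXaddC (negPf nzT) /= ltnS size_poly_gt0.
Qed.

(** [T ^+ n] divides the leading coefficient of [f], a nonzero polynomial in one variable, and its
    degree bounds [n]. *)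
Lemma divides_exc_divX_bounded f : f != 0 ->
  exists N, forall n, divides (T ^+ n) f -> (n < N)%N.
Proof.
move=> nzf; exists (size (lead_coef f)) => n.
rewrite -rmorphXn /= => /divides_polyC/(_ (size f).-1) [g]; rewrite -lead_coefE => e.
have nzl : lead_coef f != 0 by rewrite lead_coef_eq0.
have nzg : g != 0 by apply: contra_neq nzl => g0; rewrite e g0 mul0r.
rewrite e size_mul ?expf_neq0 ?polyXsubC_eq0 // size_exp_XsubC addnS /=.
by move: nzg; rewrite -size_poly_gt0; case: (size g) => // m _; rewrite ltnS leq_addl.
Qed.

End BlowupChart.

(** * The ring [A[b/a]] *)

Section AffineModification.
Variables (k : fieldType) (a b : poly2 k).
Local Notation A := (poly2 k).
Local Notation B := (Bring a b).

Lemma inclB_in (f : A) : f%:F \in Bpred a b.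
Proof. by apply/asboolP; exists f%:P; rewrite map_polyC hornerC. Qed.

Definition inclB (f : A) : B := MkB (inclB_in f).

Lemma inclB_is_zmod_morphism : zmod_morphism inclB.
Proof. by move=> f g; apply: val_inj; rewrite /= tofracB. Qed.

Lemma inclB_is_monoid_morphism : monoid_morphism inclB.
Proof.
by split=> [|f g]; apply: val_inj; rewrite /= ?tofrac1 ?tofracM.
Qed.

HB.instance Definition _ :=
  GRing.isZmodMorphism.Build A B inclB inclB_is_zmod_morphism.
HB.instance Definition _ :=
  GRing.isMonoidMorphism.Build A B inclB inclB_is_monoid_morphism.

Lemma quotB_in : b%:F / a%:F \in Bpred a b.
Proof. by apply/asboolP; exists 'X; rewrite map_polyX hornerX. Qed.

Definition quotB : B := MkB quotB_in.

Definition presB (P : {poly A}) : B := poly_eval inclB quotB P.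

HB.instance Definition _ := GRing.RMorphism.copy presB (poly_eval inclB quotB).

Lemma val_presB P : val (presB P) = (map_poly (@tofrac _) P).[b%:F / a%:F].
Proof.
rewrite /presB /poly_eval -[LHS]horner_map -map_poly_comp.
by congr (_.[_]); apply: eq_map_poly.
Qed.

Lemma presBC c : presB c%:P = inclB c.
Proof. exact: poly_evalC. Qed.

Lemma presBX : presB 'X = quotB.
Proof. exact: poly_evalX. Qed.

Lemma presBB P Q : presB (P - Q) = presB P - presB Q.
Proof. exact: rmorphB. Qed.

Lemma presB_surj (f : B) : exists P, f = presB P.
Proof.
have /asboolP[P e] := valP f; exists P; apply: val_inj.
by rewrite val_presB -e.
Qed.

Lemma inclB_inj : injective inclB.
Proof. by move=> f g /(congr1 val)/eqP; rewrite tofrac_eq => /eqP. Qed.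

Lemma inclB_constB c : inclB c%:P%:P = constB a b c.
Proof. exact: val_inj. Qed.

Lemma B_domain (f g : B) : f * g = 0 -> f = 0 \/ g = 0.
Proof.
move=> /(congr1 val)/eqP; rewrite /= mulf_eq0.
by case/orP=> /eqP e; [left | right]; apply: val_inj; rewrite /= e.
Qed.

Hypotheses (a_prime : prime_elt a) (nab : ~ divides a b).

Lemma inclB_quotB : inclB a * quotB = inclB b.
Proof.
have nza : a != 0 by case: a_prime.
by apply: val_inj; rewrite /= mulrC divfK // tofrac_eq0.
Qed.

Lemma inclB_a_neq0 : inclB a != 0.
Proof.
have nza : a != 0 by case: a_prime.
by apply: contra_neq nza => e; apply: inclB_inj; rewrite e rmorph0.
Qed.

Definition eqB : {poly A} := a%:P * 'X - b%:P.

Lemma presB_eqB : presB eqB = 0.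
Proof.
by rewrite rmorphB rmorphM /= !presBC presBX inclB_quotB subrr.
Qed.

(** Pseudo-division by [az - b] leaves a remainder in [A], which vanishes in [B] and hence in [A].
    So [az - b] divides a power of [a] times [P]; that power cancels because the prime [a] does not
    divide [az - b]. *)
Lemma presB_eq0 P : presB P = 0 -> exists Q, P = Q * eqB.
Proof.
move=> P0.
have nza : a != 0 by case: a_prime.
have geq : eqB = a%:P * 'X + (- b)%:P by rewrite polyCN.
have sg : size eqB = 2 by rewrite geq size_MXaddC polyC_eq0 (negPf nza) size_polyC nza.
have lg : lead_coef eqB = a.
  by rewrite lead_coefE sg geq coefD coefCM coefX coefC addr0 mulr1.
have divE := Pdiv.Idomain.divp_eq P eqB.
have lr : (size (P %% eqB)%R <= 1)%N.
  have : (size (P %% eqB)%R < size eqB)%N.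
    by rewrite Pdiv.Idomain.ltn_modp -size_poly_gt0 sg.
  by rewrite sg.
have r0 : P %% eqB = 0.
  have := congr1 presB divE.
  rewrite -mul_polyC rmorphM rmorphD rmorphM /=.
  rewrite P0 presB_eqB !mulr0 add0r.
  rewrite (size1_polyC lr) presBC => /esym e.
  by rewrite (inclB_inj (etrans e (esym (rmorph0 inclB)))).
rewrite r0 addr0 lg -mul_polyC rmorphXn /= in divE.
apply: (cancel_primeX (@idomain_domain _) (prime_polyC a_prime)).
  move=> /divides_polyC/(_ 0%N); rewrite geq coefD coefCM coefX coefC mulr0 add0r.
  by move/dividesN; rewrite opprK.
by exists (P %/ eqB); rewrite -divE.
Qed.

(** Denominators are cleared along the Horner scheme, using [az = b]. The invariant [S] records what
    the numerator [c] inherits from the exponent [n], morally that it lies in [(a, b)^n]. *)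
Lemma clear_denominators (S : nat -> A -> Prop) :
  S 0%N 0 -> (forall n c d, S n c -> S n.+1 (c * b + a ^+ n.+1 * d)) ->
  forall f : B, exists n c, inclB a ^+ n * f = inclB c /\ S n c.
Proof.
move=> S0 SS f; have [P ->] := presB_surj f.
elim/poly_ind: P => [|P d [n [c [e Snc]]]].
  by exists 0%N, 0; rewrite !rmorph0 mulr0.
exists n.+1, (c * b + a ^+ n.+1 * d); split; last exact: SS.
rewrite !(rmorphD, rmorphM, rmorphXn) /= presBC presBX -e -inclB_quotB.
by rewrite exprS; ring.
Qed.

Lemma clear_denominator (f : B) : exists n c, inclB a ^+ n * f = inclB c.
Proof.
have [||n [c [e _]]] := @clear_denominators (fun _ _ => True) _ _ f => //.
by exists n, c.
Qed.

Variable phi : {rmorphism A -> k}.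
Hypothesis phi_const : forall c, phi c%:P%:P = c.
Hypothesis phi_ker : forall f, phi f = 0 <-> exists p q, f = a * p + b * q.

Lemma phi_a : phi a = 0.
Proof. by apply/phi_ker; exists 1, 0; rewrite mulr1 mulr0 addr0. Qed.

Lemma phi_b : phi b = 0.
Proof. by apply/phi_ker; exists 0, 1; rewrite mulr1 mulr0 add0r. Qed.

Lemma presB_eq0_phi P : presB P = 0 -> map_poly phi P = 0.
Proof.
move/presB_eq0=> [Q ->]; rewrite rmorphM rmorphB rmorphM /= !map_polyC /=.
by rewrite phi_a phi_b mul0r subrr mulr0.
Qed.

(** [B/aB = A[z]/(a, az - b) = (A/(a, b))[z] = k[z]], the last map being [phi] on coefficients.
    Conversely [ap + bq = a(p + zq)] in [B]. *)
Lemma divides_a_presB P : divides (inclB a) (presB P) <-> map_poly phi P = 0.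
Proof.
split=> [[f]|].
  have [Q ->] := presB_surj f; rewrite -[inclB a]presBC.
  move/eqP; rewrite -[X in _ == X]rmorphM -subr_eq0 -rmorphB.
  move/eqP/presB_eq0_phi/eqP; rewrite rmorphB rmorphM /= map_polyC /= phi_a.
  by rewrite mulr0 subr0 => /eqP.
elim/poly_ind: P => [_|P c IHP /polyP e]; first by exists 0; rewrite rmorph0 mul0r.
rewrite rmorphD rmorphM /= presBC; apply: dividesD.
  apply/dividesMr/IHP/polyP=> i.
  by have := e i.+1; rewrite rmorphD rmorphM /= map_polyX map_polyC coefD coefMX coefC addr0 !coef0.
have := e 0%N; rewrite coef_map coefD coefMX coefC add0r coef0 /=.
move/phi_ker=> [p [q ->]]; rewrite rmorphD !rmorphM /= -inclB_quotB.
by exists (inclB p + quotB * inclB q); ring.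
Qed.

Lemma prime_inclB_a : prime_elt (inclB a).
Proof.
split; first exact: inclB_a_neq0.
- move=> [f e]; have /divides_a_presB : divides (inclB a) (presB 1).
    by rewrite rmorph1; exists f; rewrite mulrC e.
  by rewrite rmorph1 => /eqP; rewrite oner_eq0.
- move=> f g; have [P ->] := presB_surj f; have [Q ->] := presB_surj g.
  rewrite -rmorphM => /divides_a_presB/eqP; rewrite rmorphM mulf_eq0.
  by case/orP=> /eqP/divides_a_presB; [left | right].
Qed.

Local Notation x0 := (phi 'X%:P).
Local Notation y0 := (phi 'X).
Local Notation T := (exc_div x0).
Local Notation psi := (chart x0 y0).
Local Notation ev0 := (restr_exc x0).

Lemma phi_exc_div : phi T = 0.
Proof. by rewrite /exc_div polyCB rmorphB /= phi_const subrr. Qed.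

(** The chart contracts the line [T = 0] to the point at which [phi] evaluates. *)
Lemma restr_chart f : ev0 (psi f) = (phi f)%:P.
Proof.
elim/poly2_closed_ind: f => [c||||].
- by rewrite chartC restr_excC hornerC phi_const.
- by rewrite chartC restr_excC hornerX.
- rewrite chartX rmorphD rmorphM /= [ev0 T]restr_excC !restr_excC restr_excX.
  by rewrite !hornerE subrr mul0r addr0.
- by move=> p q ep eq; rewrite !rmorphD /= ep eq.
- by move=> p q ep eq; rewrite !rmorphM /= ep eq.
Qed.

Lemma chart_kernel f : phi f = 0 -> divides T (psi f).
Proof. by move=> f0; apply/divides_exc_div; rewrite restr_chart f0. Qed.

(* [T] and [Y - y0] lie in [(a, b)] and become [T] and [T * 'X] in the chart. *)
(* If [T ^ 2] divided the image of [a], then dividing by [T] and restricting  *)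
(* to [T = 0] would make [1] and ['X] constant multiples of one polynomial.   *)
Lemma chart_a : exists a1, psi a = a1 * T /\ ~ divides T a1.
Proof.
have [a1 ea] := chart_kernel phi_a; have [b1 eb] := chart_kernel phi_b.
exists a1; split=> // /divides_exc_div a10.
have nzT : T != 0 by case: (prime_exc_div x0).
have quot f h : phi f = 0 -> psi f = T * h -> exists q, ev0 h = ev0 b1 * (phi q)%:P.
  move=> /phi_ker[p [q ->]]; rewrite rmorphD !rmorphM /= ea eb => e.
  exists q; have -> : h = a1 * psi p + b1 * psi q.
    by apply: (mulfI nzT); rewrite -e; ring.
  by rewrite rmorphD !rmorphM /= a10 mul0r add0r restr_chart.
have [|q1 e1] := quot T 1 phi_exc_div; first by rewrite mulr1 chart_exc_div.
have [||q2 e2] := quot ('X - y0%:P%:P) 'X; first by rewrite rmorphB /= phi_const subrr.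
  exact: chart_Y.
rewrite rmorph1 in e1; rewrite restr_excX in e2.
have /polyP/(_ 1%N) : 'X * (phi q1)%:P = (phi q2)%:P.
  rewrite e2 -[RHS]mul1r [in RHS]e1; ring.
rewrite coefXM coefC /= coefC /= => q10.
by move: e1; rewrite q10 mulr0 => /eqP; rewrite oner_eq0.
Qed.

(** If [c = a^n f] in [B] and [a^m f = c'] lies in [A], then [a^m c = a^n c']. In the chart [a] is
    [a1 * T] and [T^m] divides [c'], so cancelling [T^m] shows that [T^n] divides [a1^m * psi c]. As
    the prime [T] does not divide [a1], it follows that [T^n] divides [psi c], which bounds [n]. *)
Lemma divides_aX_bounded (c : A) : c != 0 ->
  exists N, forall n, divides (inclB a ^+ n) (inclB c) -> (n < N)%N.
Proof.
move=> nzc; have [a1 [ea na1]] := chart_a.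
have [|N NP] := @divides_exc_divX_bounded _ x0 (psi c).
  by apply: contra_neq nzc; apply: chart_eq0.
exists N => n [f ef]; apply: NP.
have [||m [c' [ec' [w ew]]]] := @clear_denominators (fun n c => divides (T ^+ n) (psi c)) _ _ f.
- by rewrite rmorph0; exists 0; rewrite mul0r.
- move=> i g d [w ew]; have [b1 eb] := chart_kernel phi_b.
  rewrite rmorphD !rmorphM rmorphXn /= ew ea eb.
  exists (w * b1 + a1 ^+ i.+1 * psi d).
  by rewrite exprMn !exprS; ring.
have e : a ^+ m * c = a ^+ n * c'.
  by apply: inclB_inj; rewrite !rmorphM !rmorphXn /= ef -ec'; ring.
have nzT : T != 0 by case: (prime_exc_div x0).
have : divides (T ^+ n) (a1 ^+ m * psi c).
  exists (a1 ^+ n * w); apply: (mulfI (expf_neq0 m nzT)).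
  have := congr1 psi e; rewrite !rmorphM !rmorphXn /= ew ea !exprMn => e'.
  transitivity (a1 ^+ m * T ^+ m * psi c); first by ring.
  by rewrite e'; ring.
apply: (divides_primeX_cancel (@idomain_domain _) (prime_exc_div x0)).
by move/(prime_dividesX (prime_exc_div x0)).
Qed.

End AffineModification.

(** * Factoriality and units of [A[b/a]] *)

Lemma maximal_exponent (R : comNzRingType) (p x : R) :
  (exists N, forall n, divides (p ^+ n) x -> (n < N)%N) ->
  exists n y, x = p ^+ n * y /\ ~ divides p y.
Proof.
move=> [N NP]; elim: N x NP => [|N IHN] x NP.
  by have /NP : divides (p ^+ 0) x by exists x; rewrite mulr1.
have [[y ex]|nx] := pselect (divides p x); last by exists 0%N, x; rewrite mul1r.
have [|n [z [ey nz]]] := IHN y; last by exists n.+1, z; rewrite exprSr ex ey; split=> //; ring.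
move=> n [z ey]; rewrite -ltnS; apply: NP; exists z; rewrite ex ey exprSr; ring.
Qed.

Lemma divisor_primeX (R : comNzRingType) (p x y : R) n :
  (forall x y : R, x * y = 0 -> x = 0 \/ y = 0) ->
  prime_elt p -> x * y = p ^+ n -> exists u i, is_unit u /\ x = u * p ^+ i.
Proof.
move=> dom Pp; have [nzp _ pP] := Pp; elim: n x y => [|n IHn] x y e.
  by exists x, 0%N; rewrite mulr1; split=> //; exists y.
have [|[z ez]|[z ez]] := pP x y; first by rewrite e exprSr; exists (p ^+ n).
- have [|u [i [Uu eu]]] := IHn z y.
    apply: (mulfI_domain dom nzp); rewrite -exprS -e ez; ring.
  by exists u, i.+1; rewrite ez eu exprSr mulrA.
- apply: (IHn x z); apply: (mulfI_domain dom nzp); rewrite -exprS -e ez; ring.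
Qed.

Section AffineModificationUFD.
Variables (k : fieldType) (a b : poly2 k).
Local Notation A := (poly2 k).
Local Notation B := (Bring a b).
Hypotheses (a_prime : prime_elt a) (nab : ~ divides a b).
Variable phi : {rmorphism A -> k}.
Hypothesis phi_const : forall c, phi c%:P%:P = c.
Hypothesis phi_ker : forall f, phi f = 0 <-> exists p q, f = a * p + b * q.

Local Notation iB := (@inclB k a b).
Local Notation domB := (@B_domain k a b).
Local Notation a_primeB := (prime_inclB_a a_prime nab phi_ker).

(** If [q] is not associated to [a], write [q = a^e f] in [B] with [a] not dividing [f]. A relation
    [f | xy] in [B] becomes, after clearing denominators, one for [q] in [A]; what [q] then divides
    is [x] or [y] times a power of [a], which [f] ignores. *)
Lemma factors_inclB_prime (q : A) : prime_elt q -> factors (iB q).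
Proof.
move=> Pq; have domA := @idomain_domain A.
have [nza Ua _] := a_prime; have [nzq Uq qP] := Pq.
have [_ [_ irrq]] := prime_irreducible domA Pq.
have [_ [_ irra]] := prime_irreducible domA a_prime.
have [[z ez]|naq] := pselect (divides a q).
  have [[z' ez']|//] := irrq _ _ ez.
  rewrite ez rmorphM /=; apply: factorsM; last exact: factors_prime a_primeB.
  by apply: factors_unit; exists (iB z'); rewrite -rmorphM ez' rmorph1.
have nqa : ~ divides q a.
  move=> [z ez]; have [[z' ez']|//] := irra _ _ ez.
  by apply: naq; exists z'; rewrite ez mulrA [z' * z]mulrC ez' mul1r.
have [e [f [ef naf]]] := maximal_exponent
  (divides_aX_bounded a_prime phi_const phi_ker nzq).
have fq n x : divides (iB q) (iB a ^+ n * x) -> divides f x.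
  move=> [y ey]; apply: (cancel_primeX domB (n := n) a_primeB naf).
  by exists (y * iB a ^+ e); rewrite ey ef; ring.
rewrite ef; apply: factorsM.
  by elim: (e) => [|i Fi]; rewrite ?exprS; [exact: factors_unit (is_unit1 _)
    | apply: factorsM Fi; exact: factors_prime a_primeB].
have [Uf|Uf] := pselect (is_unit f); first exact: factors_unit.
apply: factors_prime; split=> //.
  by apply: contra_neq nzq => f0; apply: (@inclB_inj _ a b); rewrite ef f0 mulr0 rmorph0.
move=> x y [r er].
have [i [x' ex]] := clear_denominator a_prime x.
have [j [y' ey]] := clear_denominator a_prime y.
have [l [r' er']] := clear_denominator a_prime r.
(* [a^e] rebuilds [q] from [f], and [a^l] clears the denominator of the cofactor [r]. *)
have /qP[/(prime_dividesX Pq)//|/qP[]] :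
    divides q (a ^+ (l + e) * (x' * y')).
  exists (a ^+ (i + j) * r'); apply: (@inclB_inj _ a b).
  rewrite !rmorphM !rmorphXn /= -ex -ey -er' ef !exprD.
  transitivity (iB a ^+ l * iB a ^+ e * iB a ^+ i * iB a ^+ j * (x * y)).
    by ring.
  by rewrite er; ring.
- move=> [z ez]; left; apply: (fq i); rewrite ex ez rmorphM.
  by exists (iB z).
- move=> [z ez]; right; apply: (fq j); rewrite ey ez rmorphM.
  by exists (iB z).
Qed.

Lemma B_factorial : factorial_ring B.
Proof.
move=> f nzf; have [n [c e]] := clear_denominator a_prime f.
have nzaf : f * iB a ^+ n != 0.
  apply: (mul_neq0_domain domB nzf); apply: (exp_neq0_domain domB).
  exact: inclB_a_neq0.
have nzc : c != 0.
  by apply: contra_neq nzaf => c0; rewrite mulrC e c0 rmorph0.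
apply: (factors_divisor domB nzaf); rewrite mulrC e.
have [u [s [[u' eu] Ps ->]]] := poly2_factorial nzc.
rewrite rmorphM rmorph_prod /=; apply: factorsM.
  by apply: factors_unit; exists (iB u'); rewrite -rmorphM eu rmorph1.
rewrite -(big_map iB predT id); apply: factors_prod => _ /mapP[q /Ps Pq ->].
exact: factors_inclB_prime.
Qed.

(** Clearing denominators in [u * v = 1] gives [g * h = a^(n+m)] in [A], so [g = c a^i] and
    [a^n u = c a^i]. Unless [n = i], this would make [a] a unit of [B]. *)
Lemma B_units (u : B) : is_unit u <-> exists c, c != 0 /\ u = constB a b c.
Proof.
have Ua : ~ is_unit (iB a) by case: a_primeB.
split=> [[v e]|[c [nzc ->]]]; last first.
  exists (constB a b c^-1); rewrite -!inclB_constB -rmorphM -!polyCM divff //.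
  by rewrite rmorph1.
have [n [g eg]] := clear_denominator a_prime u.
have [m [h eh]] := clear_denominator a_prime v.
have egh : g * h = a ^+ (n + m).
  apply: (@inclB_inj _ a b); rewrite rmorphM rmorphXn /= -eg -eh exprD.
  by rewrite -[RHS]mulr1 -e; ring.
have [w [i [/is_unit_polyC[w' [/is_unit_polyC[c [[c' ec] ->]] ->]] ew]]] :=
  divisor_primeX (@idomain_domain _) a_prime egh.
have nzc : c != 0.
  by apply: contra_eq_neq ec => ->; rewrite mul0r eq_sym oner_neq0.
have ewB : iB a ^+ n * u = constB a b c * iB a ^+ i.
  by rewrite eg ew rmorphM rmorphXn /= inclB_constB.
have Uc : is_unit (constB a b c).
  by exists (constB a b c'); rewrite -!inclB_constB -rmorphM -!polyCM ec rmorph1.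
have nza : iB a != 0 by apply: inclB_a_neq0.
have nzaX j : iB a ^+ j != 0.
  exact: (exp_neq0_domain domB).
exists c; split=> //; case: (ltngtP n i) => ni.
- case: Ua; apply: (@is_unit_mulr _ (constB a b c * iB a ^+ (i - n).-1)).
  exists v; rewrite -e; congr (_ * _); apply: (mulfI_domain domB (nzaX n)).
  rewrite ewB -mulrA -exprSr prednK ?subn_gt0 // -{2}(subnKC (ltnW ni)) exprD; ring.
- case: Ua; apply: (@is_unit_mull _ (iB a) (iB a ^+ (n - i).-1 * u)).
  suff -> : iB a * (iB a ^+ (n - i).-1 * u) = constB a b c by [].
  apply: (mulfI_domain domB (nzaX i)); rewrite [RHS]mulrC -ewB.
  by rewrite -{2}(subnKC (ltnW ni)) exprD mulrA -exprS prednK ?subn_gt0 // mulrA.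
- by apply: (mulfI_domain domB (nzaX n)); rewrite ewB ni mulrC.
Qed.
End AffineModificationUFD.

(** * Algebraic dependence and Krull dimension *)

Section LinearDependence.
Variable k : fieldType.

Definition bidegree_le (d : nat) (p : poly2 k) : Prop :=
  (size p <= d.+1)%N /\ forall i, (size (p`_i)%R <= d.+1)%N.

Lemma bidegree_le_ex (p : poly2 k) : exists d, bidegree_le d p.
Proof.
exists (size p + \max_(i < size p) size (p`_i)%R)%N; split.
  by rewrite -addnS leq_addr.
move=> i; have [pi|ip] := leqP (size p) i; first by rewrite nth_default ?size_poly0.
apply: leqW; apply: leq_trans (leq_addl _ _).
exact: (leq_bigmax (Ordinal ip)).
Qed.

Lemma bidegree_leW d e p : (d <= e)%N -> bidegree_le d p -> bidegree_le e p.
Proof.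
by move=> de [s c]; split=> [|i]; apply: leq_trans (de : (d.+1 <= e.+1)%N).
Qed.

Lemma bidegree_leM d e p q :
  bidegree_le d p -> bidegree_le e q -> bidegree_le (d + e) (p * q).
Proof.
have bound (R : nzRingType) (u v : {poly R}) :
    (size u <= d.+1)%N -> (size v <= e.+1)%N -> (size (u * v)%R <= (d + e).+1)%N.
  move=> lu lv; apply: leq_trans (size_polyMleq _ _) _; lia.
move=> [sp cp] [sq cq]; split; first exact: bound.
move=> i; rewrite coefM; apply: leq_trans (size_sum _ _ _) _.
by apply/bigmax_leqP => j _; apply: bound.
Qed.

Lemma bidegree_leX d p n : bidegree_le d p -> bidegree_le (n * d) (p ^+ n).
Proof.
move=> bp; elim: n => [|n IHn]; last by rewrite exprS mulSn; apply: bidegree_leM.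
split=> [|i]; first by rewrite size_poly1.
by rewrite coef1; case: (i == 0%N); rewrite ?size_poly1 ?size_poly0.
Qed.

(** The coefficient matrix has more rows than its [(d+1)^2] columns, so it has a nonzero left kernel
    vector. *)
Lemma bidegree_dependence (I : finType) (F : I -> poly2 k) d :
  (forall i, bidegree_le d (F i)) -> (d.+1 * d.+1 < #|I|)%N ->
  exists c : I -> k, (exists i, c i != 0) /\ \sum_i (c i)%:P%:P * F i = 0.
Proof.
move=> bF lI.
pose M : 'M[k]_(#|I|, d.+1 * d.+1) :=
  \matrix_i mxvec (\matrix_(j, l) (F (enum_val i))`_(j : 'I_d.+1)`_(l : 'I_d.+1)).
have /rowV0Pn[v /sub_kermxP vM nzv] : kermx M != 0.
  rewrite -mxrank_eq0 mxrank_ker subn_eq0 -ltnNge.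
  exact: leq_ltn_trans (rank_leq_col _) lI.
exists (fun i => v 0 (enum_rank i)); split.
  have [j nzj] : exists j, v 0 j != 0.
    apply/existsP; apply: contraNT nzv; rewrite negb_exists => /forallP v0.
    by apply/eqP/rowP=> j; rewrite mxE; apply/eqP; rewrite -[_ == _]negbK.
  by exists (enum_val j); rewrite enum_valK.
apply/polyP=> j; apply/polyP=> l; rewrite coef_sum coef_sum !coef0.
under eq_bigr do rewrite !coefCM.
have [dj|jd] := leqP d.+1 j.
  apply: big1 => i _; rewrite (nth_default 0 (leq_trans (bF i).1 dj)).
  by rewrite coef0 mulr0.
have [dl|ld] := leqP d.+1 l.
  by apply: big1 => i _; rewrite (nth_default 0 (leq_trans ((bF i).2 j) dl)) mulr0.
have /rowP/(_ (mxvec_index (Ordinal jd) (Ordinal ld))) := vM.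
rewrite !mxE => e; rewrite -[RHS]e (reindex (fun i : 'I_#|I| => enum_val i)) /=;
  last exact/onW_bij/enum_val_bij.
by apply: eq_bigr => i _; rewrite enum_valK mxE mxvecE mxE.
Qed.

End LinearDependence.

Section PrimeIdeals.
Variable R : comNzRingType.

Lemma prime_ideal_divides (p : R) : prime_elt p -> is_prime_ideal (divides p).
Proof.
move=> [nzp Up pP]; split=> //; last by move/(divides_unit (is_unit1 _)).
split; [by exists 0; rewrite mul0r | exact: dividesD | by move=> r x; apply: dividesMl].
Qed.

(** Since [x] is outside the prime [I], powers of [x] can be divided out of [Q] until its constant
    term is nonzero; modulo [J], which contains [x], only that term survives. Each strict inclusion
    of primes thus eliminates one variable. *)
Lemma chain_step (D : comNzRingType) (h : {rmorphism D -> R}) (x : R)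
    (I J : R -> Prop) (Q : {poly D}) :
  is_prime_ideal I -> is_prime_ideal J -> (forall y, I y -> J y) ->
  J x -> ~ I x -> Q != 0 -> I (poly_eval h x Q) -> exists c, c != 0 /\ J (h c).
Proof.
move=> [_ _ Iprime] [[_ JD JM] _ _] IJ Jx nIx; elim/poly_ind: Q => [|Q c IHQ nzQ].
  by rewrite eqxx.
rewrite rmorphD rmorphM /= poly_evalC poly_evalX => IQ.
have [c0|nzc] := eqVneq c 0; last first.
  exists c; split=> //.
  have -> : h c = poly_eval h x Q * x + h c + (- poly_eval h x Q) * x by ring.
  by apply: JD; [exact: IJ | exact: JM].
move: nzQ IQ; rewrite c0 !rmorph0 !addr0 => nzQ Ix; have [IQ|//] := Iprime _ _ Ix.
by apply: IHQ => //; apply: contra_neq nzQ => ->; rewrite mul0r.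
Qed.

Lemma no_prime_chain3 (k : fieldType) (iota : {rmorphism k -> R}) :
  (forall x y z : R, exists Q : {poly {poly {poly k}}}, Q != 0 /\
     poly_eval (poly_eval (poly_eval iota z) y) x Q = 0) ->
  ~ exists P : nat -> R -> Prop, prime_chain 3 P.
Proof.
move=> dep [P [Pprime Pstrict]].
have [P01 [x [P1x P0x]]] := Pstrict 0%N isT.
have [P12 [y [P2y P1y]]] := Pstrict 1%N isT.
have [P23 [z [P3z P2z]]] := Pstrict 2%N isT.
have [Q [nzQ Q0]] := dep x y z.
have PQ : P 0%N (poly_eval (poly_eval (poly_eval iota z) y) x Q).
  by rewrite Q0; case: (Pprime 0%N isT) => -[].
have [Q1 [nzQ1 PQ1]] := chain_step (Pprime 0%N isT) (Pprime 1%N isT) P01 P1x P0x nzQ PQ.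
have [Q2 [nzQ2 PQ2]] := chain_step (Pprime 1%N isT) (Pprime 2%N isT) P12 P2y P1y nzQ1 PQ1.
have [c [nzc Pc]] := chain_step (Pprime 2%N isT) (Pprime 3%N isT) P23 P3z P2z nzQ2 PQ2.
have [[_ _ P3M] nP31 _] := Pprime 3%N isT.
by apply: nP31; have := P3M (iota c^-1) _ Pc; rewrite -rmorphM mulVf // rmorph1.
Qed.

End PrimeIdeals.

Lemma poly_eval_poly (D R : comNzRingType) (h : {rmorphism D -> R}) (x : R) n E :
  poly_eval h x (\poly_(i < n) E i) = \sum_(i < n) h (E i) * x ^+ i.
Proof.
rewrite poly_def rmorph_sum; apply: eq_bigr => i _.
by rewrite -mul_polyC rmorphM rmorphXn /= poly_evalC poly_evalX.
Qed.

(** * Finite type and Krull dimension of [A[b/a]] *)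

Section AffineModificationDimension.
Variables (k : fieldType) (a b : poly2 k).
Local Notation A := (poly2 k).
Local Notation B := (Bring a b).
Local Notation iB := (@inclB k a b).
Local Notation cB := (@constB k a b).

Lemma constB_is_zmod_morphism : zmod_morphism cB.
Proof. by move=> c d; apply: val_inj; rewrite /= !polyCB tofracB. Qed.

Lemma constB_is_monoid_morphism : monoid_morphism cB.
Proof. by split=> [|c d]; apply: val_inj; rewrite /= ?tofrac1 ?polyCM ?tofracM. Qed.

HB.instance Definition _ :=
  GRing.isZmodMorphism.Build k B cB constB_is_zmod_morphism.
HB.instance Definition _ :=
  GRing.isMonoidMorphism.Build k B cB constB_is_monoid_morphism.

Lemma B_finite_type : finite_type_over cB.
Proof.
exists [:: iB 'X%:P; iB 'X; quotB a b] => S Sc Ss SD SM f.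
have [P ->] := presB_surj f; elim/poly3_closed_ind: P => [c||||p q Sp Sq|p q Sp Sq].
- by rewrite presBC inclB_constB.
- by rewrite presBC; apply: Ss; rewrite inE eqxx.
- by rewrite presBC; apply: Ss; rewrite !inE eqxx orbT.
- by rewrite presBX; apply: Ss; exact: (mem_last (iB 'X%:P) [:: iB 'X; quotB a b]).
- by rewrite rmorphD; apply: SD.
- by rewrite rmorphM; apply: SM.
Qed.

Hypotheses (a_prime : prime_elt a) (nab : ~ divides a b).

(* With a common denominator [d] of [x], [y], [z], the [N ^ 3] monomials of *)
(* degree [< N] in each variable become, after multiplication by            *)
(* [d ^ (3 * N)], elements of [k[x,y]] of bidegree [O(N)], a space of       *)
(* dimension [O(N ^ 2)].                                                     *)
Lemma B_dependence (x y z : B) : exists Q : {poly {poly {poly k}}},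
  Q != 0 /\ poly_eval (poly_eval (poly_eval cB z) y) x Q = 0.
Proof.
have [n1 [f1 e1]] := clear_denominator a_prime x.
have [n2 [f2 e2]] := clear_denominator a_prime y.
have [n3 [f3 e3]] := clear_denominator a_prime z.
have [d [g1 [g2 [g3 [nzd h1 h2 h3]]]]] : exists d g1 g2 g3, [/\ iB d != 0,
    iB d * x = iB g1, iB d * y = iB g2 & iB d * z = iB g3].
  exists (a ^+ (n1 + n2 + n3)), (a ^+ (n2 + n3) * f1), (a ^+ (n1 + n3) * f2).
  exists (a ^+ (n1 + n2) * f3).
  rewrite !rmorphM !rmorphXn /= -e1 -e2 -e3 !exprD; split; try ring.
  by rewrite -!exprD; apply: (exp_neq0_domain (@B_domain _ a b)); apply: inclB_a_neq0.
have [D [Dd D1 D2 D3]] : exists D, [/\ bidegree_le D d, bidegree_le D g1,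
    bidegree_le D g2 & bidegree_le D g3].
  have [m0 b0] := bidegree_le_ex d; have [m1 b1] := bidegree_le_ex g1.
  have [m2 b2] := bidegree_le_ex g2; have [m3 b3] := bidegree_le_ex g3.
  exists (m0 + m1 + m2 + m3)%N.
  by split; [move: b0 | move: b1 | move: b2 | move: b3]; apply: bidegree_leW; lia.
(* Bidegrees are at most [3ND], and [(3ND + 1)^2 <= 9 N^2 (D+1)^2 < N^3] for this [N]. *)
pose N := (9 * (D.+1 * D.+1)).+1.
pose I : finType := ('I_N * 'I_N * 'I_N)%type.
pose F (t : I) := g1 ^+ t.1.1 * g2 ^+ t.1.2 * g3 ^+ t.2 *
  d ^+ (3 * N - (t.1.1 + t.1.2 + t.2)).
have [|| c [[t0 nzc] sumc]] := @bidegree_dependence k I F (3 * N * D)%N.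
- move=> [[i j] l]; rewrite /F /=.
  have -> : (3 * N * D = i * D + j * D + l * D + (3 * N - (i + j + l)) * D)%N.
    by rewrite -!mulnDl; congr muln; have := ltn_ord i; have := ltn_ord j; have := ltn_ord l; lia.
  by do ?[apply: bidegree_leM | apply: bidegree_leX].
- rewrite !card_prod !card_ord.
  have le1 : ((3 * N * D).+1 <= 3 * N * D.+1)%N by rewrite mulnS /N; lia.
  apply: leq_ltn_trans (leq_mul le1 le1) _.
  have -> : (3 * N * D.+1 * (3 * N * D.+1) = N * N * (9 * (D.+1 * D.+1)))%N by ring.
  by rewrite ltn_pmul2l // muln_gt0.
pose G (i j l : nat) := c (inord i, inord j, inord l).
pose Q := \poly_(i < N) \poly_(j < N) \poly_(l < N) G i j l.
exists Q; split.
  apply: contra_neq nzc => Q0; case: t0 => [[i j] l].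
  have := congr1 (fun p : {poly {poly {poly k}}} => p`_i`_j`_l) Q0.
  by rewrite /Q !coef_poly !ltn_ord coef_poly !ltn_ord coef_poly !ltn_ord /G !inord_val !coef0.
have evQ : poly_eval (poly_eval (poly_eval cB z) y) x Q =
    \sum_(t : I) cB (c t) * (x ^+ t.1.1 * y ^+ t.1.2 * z ^+ t.2).
  transitivity (\sum_(i < N) \sum_(j < N) \sum_(l < N)
      cB (c (i, j, l)) * (x ^+ i * y ^+ j * z ^+ l)).
    rewrite poly_eval_poly; apply: eq_bigr => i _ /=.
    rewrite poly_eval_poly mulr_suml; apply: eq_bigr => j _ /=.
    rewrite poly_eval_poly !mulr_suml; apply: eq_bigr => l _.
    by rewrite /G !inord_val; ring.
  by rewrite pair_bigA pair_bigA /=; apply: eq_bigr => -[[i j] l] _.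
apply: (mulfI_domain (@B_domain _ a b) (x := iB d ^+ (3 * N))).
  exact: (exp_neq0_domain (@B_domain _ a b)).
rewrite mulr0 evQ -[RHS](rmorph0 iB) -sumc rmorph_sum mulr_sumr.
apply: eq_bigr => -[[i j] l] _.
rewrite /F !rmorphM !rmorphXn /= inclB_constB -h1 -h2 -h3 !exprMn.
have {1}-> : (3 * N = i + j + l + (3 * N - (i + j + l)))%N.
  by have := ltn_ord i; have := ltn_ord j; have := ltn_ord l; lia.
by rewrite !exprD; ring.
Qed.

Variable phi : {rmorphism A -> k}.
Hypothesis phi_const : forall c, phi c%:P%:P = c.
Hypothesis phi_ker : forall f, phi f = 0 <-> exists p q, f = a * p + b * q.

(* The point [b/a = 0] of the exceptional line [B/aB = k[b/a]]. *)
Definition origin_ideal (f : B) : Prop :=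
  exists P, f = presB a b P /\ (map_poly phi P).[0] = 0.

Lemma origin_idealP P : origin_ideal (presB a b P) <-> (map_poly phi P).[0] = 0.
Proof.
split=> [[Q [e eQ]]|]; last by exists P.
have /(presB_eq0_phi a_prime nab phi_ker)/eqP : presB a b (P - Q) = 0.
  by rewrite presBB e subrr.
by rewrite rmorphB subr_eq0 => /eqP->.
Qed.

Lemma prime_origin_ideal : is_prime_ideal origin_ideal.
Proof.
split.
- split.
  + by exists 0; rewrite !rmorph0 horner0.
  + move=> _ _ [P [-> eP]] [Q [-> eQ]]; exists (P + Q).
    by rewrite !rmorphD hornerD eP eQ addr0.
  + move=> r _ [P [-> eP]]; have [R ->] := presB_surj r; exists (R * P).
    by rewrite !rmorphM hornerM eP mulr0.
- rewrite -(rmorph1 (presB a b)) => /origin_idealP/eqP.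
  by rewrite rmorph1 hornerC oner_eq0.
- move=> f g; have [P ->] := presB_surj f; have [Q ->] := presB_surj g.
  rewrite -rmorphM => /origin_idealP/eqP; rewrite rmorphM hornerM mulf_eq0.
  by case/orP=> /eqP/origin_idealP; [left | right].
Qed.

Lemma B_krull_dim : krull_dim_eq B 2.
Proof.
split; last exact: (no_prime_chain3 (iota := cB) B_dependence).
have a_primeB := prime_inclB_a a_prime nab phi_ker.
exists (fun n => match n with 0%N => eq^~ 0 | 1%N => divides (iB a) | _ => origin_ideal end).
split=> [[|[|[|//]]] _|[|[|//]] _].
- split=> [||f g /(@B_domain _ a b)//].
    split=> // [f g -> ->|f g ->]; first by rewrite addr0.
    by rewrite mulr0.
  by move/eqP; rewrite oner_eq0.
- exact: prime_ideal_divides.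
- exact: prime_origin_ideal.
- split=> [_ ->|]; first by exists 0; rewrite mul0r.
  exists (iB a); split; first by exists 1; rewrite mul1r.
  by case: a_primeB => /eqP.
- split=> [f|].
    have [P ->] := presB_surj f.
    move/(divides_a_presB a_prime nab phi_ker) => P0; apply/origin_idealP.
    by rewrite P0 horner0.
  exists (presB a b 'X); split; first by apply/origin_idealP; rewrite map_polyX hornerX.
  move/(divides_a_presB a_prime nab phi_ker)/eqP.
  by rewrite map_polyX polyX_eq0.
Qed.

End AffineModificationDimension.

Lemma row_kernel_basis (k : fieldType) n (G : 'cV[k]_n.+1) : G != 0 ->
  exists W : 'M[k]_(n, n.+1), [/\ row_free W, W *m G = 0 &
    forall v : 'rV_n.+1, v *m G = 0 -> exists c : 'rV_n, v = c *m W].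
Proof.
move=> nzG; have rG : \rank G = 1%N.
  by apply/eqP; rewrite eqn_leq rank_leq_col lt0n mxrank_eq0.
have rK : \rank (kermx G) = n by rewrite mxrank_ker rG subn1.
suff : exists W : 'M[k]_(\rank (kermx G), n.+1), [/\ row_free W, W *m G = 0 &
    forall v : 'rV_n.+1, v *m G = 0 -> exists c : 'rV_(\rank (kermx G)), v = c *m W].
  by rewrite rK.
exists (row_base (kermx G)); split.
- exact: row_base_free.
- by apply/sub_kermxP; rewrite eq_row_base.
- by move=> v /sub_kermxP; rewrite -(eq_row_base (kermx G)) => /submxP.
Qed.

(** * Tangent spaces *)

Section TangentSpace.
Variables (k : fieldType) (a b : poly2 k).
Local Notation A := (poly2 k).
Local Notation B := (Bring a b).
Local Notation pB := (@presB k a b).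
Local Notation cB := (@constB k a b).
Hypotheses (a_prime : prime_elt a) (nab : ~ divides a b).
Variable phi : {rmorphism A -> k}.
Hypothesis phi_const : forall c, phi c%:P%:P = c.
Hypothesis phi_ker : forall f, phi f = 0 <-> exists p q, f = a * p + b * q.
Variable theta : B -> k.
Hypothesis theta_point : kalg_point cB theta.

Local Notation ix := (@Ordinal 3 0 isT).
Local Notation iy := (@Ordinal 3 1 isT).
Local Notation iz := (@Ordinal 3 2 isT).
Local Notation pt P := (theta (pB P)).

Lemma thetaD f g : theta (f + g) = theta f + theta g.
Proof. by case: theta_point. Qed.

Lemma thetaM f g : theta (f * g) = theta f * theta g.
Proof. by case: theta_point. Qed.

Lemma theta_const c : theta (cB c) = c.
Proof. by case: theta_point. Qed.

Lemma theta0 : theta 0 = 0.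
Proof. by apply: (addrI (theta 0)); rewrite -thetaD !addr0. Qed.

Lemma presB_const c : pB c%:P%:P%:P = cB c.
Proof. by rewrite presBC inclB_constB. Qed.

(** Substitution of [p + tv] for the coordinates, where [p] is the point of affine 3-space under
    [theta]. Its [t]-coefficient is the derivative along [v], and the product rule comes from
    multiplicativity. *)
Definition tangent_line (v : 'rV[k]_3) (P : {poly A}) : {poly k} :=
  poly_eval (poly_eval (poly_eval (@polyC k)
    ((pt 'X%:P%:P)%:P + v 0 ix *: 'X)) ((pt 'X%:P)%:P + v 0 iy *: 'X))
    ((pt 'X)%:P + v 0 iz *: 'X) P.

HB.instance Definition _ v := GRing.RMorphism.copy (tangent_line v)
  (poly_eval (poly_eval (poly_eval (@polyC k)
    ((pt 'X%:P%:P)%:P + v 0 ix *: 'X)) ((pt 'X%:P)%:P + v 0 iy *: 'X))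
    ((pt 'X)%:P + v 0 iz *: 'X)).

Definition dir_deriv (v : 'rV[k]_3) (P : {poly A}) : k := (tangent_line v P)`_1.

Lemma tangent_line_const v c : tangent_line v c%:P%:P%:P = c%:P.
Proof. by rewrite /tangent_line poly_evalC /= poly_evalC /= poly_evalC. Qed.

Lemma tangent_line_x v : tangent_line v 'X%:P%:P = (pt 'X%:P%:P)%:P + v 0 ix *: 'X.
Proof. by rewrite /tangent_line poly_evalC /= poly_evalC /= poly_evalX. Qed.

Lemma tangent_line_y v : tangent_line v 'X%:P = (pt 'X%:P)%:P + v 0 iy *: 'X.
Proof. by rewrite /tangent_line poly_evalC /= poly_evalX. Qed.

Lemma tangent_line_z v : tangent_line v 'X = (pt 'X)%:P + v 0 iz *: 'X.
Proof. by rewrite /tangent_line poly_evalX. Qed.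

Lemma tangent_line0 v P : (tangent_line v P)`_0 = pt P.
Proof.
have base (c d : k) : (c%:P + d *: 'X)`_0 = c.
  by rewrite coefD coefC coefZ coefX mulr0 addr0.
elim/poly3_closed_ind: P => [c||||p q ep eq|p q ep eq].
- by rewrite tangent_line_const coefC presB_const theta_const.
- by rewrite tangent_line_x base.
- by rewrite tangent_line_y base.
- by rewrite tangent_line_z base.
- by rewrite !rmorphD coefD ep eq thetaD.
- by rewrite !rmorphM coef0M ep eq thetaM.
Qed.

Lemma dir_derivD v P Q : dir_deriv v (P + Q) = dir_deriv v P + dir_deriv v Q.
Proof. by rewrite /dir_deriv rmorphD coefD. Qed.

Lemma dir_derivB v P Q : dir_deriv v (P - Q) = dir_deriv v P - dir_deriv v Q.
Proof. by rewrite /dir_deriv rmorphB coefB. Qed.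

Lemma dir_derivM v P Q :
  dir_deriv v (P * Q) = pt P * dir_deriv v Q + pt Q * dir_deriv v P.
Proof.
rewrite /dir_deriv rmorphM coefM big_ord_recl big_ord1 /= !tangent_line0.
by rewrite [in X in _ + X]mulrC.
Qed.

Lemma dir_deriv_const v c : dir_deriv v c%:P%:P%:P = 0.
Proof. by rewrite /dir_deriv tangent_line_const coefC. Qed.

Lemma coef1_line (c d : k) : (c%:P + d *: 'X)`_1 = d.
Proof. by rewrite coefD coefC coefZ coefX mulr1 add0r. Qed.

Lemma dir_deriv_x v : dir_deriv v 'X%:P%:P = v 0 ix.
Proof. by rewrite /dir_deriv tangent_line_x coef1_line. Qed.

Lemma dir_deriv_y v : dir_deriv v 'X%:P = v 0 iy.
Proof. by rewrite /dir_deriv tangent_line_y coef1_line. Qed.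

Lemma dir_deriv_z v : dir_deriv v 'X = v 0 iz.
Proof. by rewrite /dir_deriv tangent_line_z coef1_line. Qed.

Lemma dir_deriv_sum n (c : 'I_n -> k) (w : 'I_n -> 'rV[k]_3) P :
  dir_deriv (\sum_i c i *: w i) P = \sum_i c i * dir_deriv (w i) P.
Proof.
have entry j : (\sum_i c i *: w i) 0 j = \sum_i c i * w i 0 j.
  by rewrite summxE; apply: eq_bigr => i _; rewrite mxE.
elim/poly3_closed_ind: P => [d||||p q ep eq|p q ep eq].
- by rewrite dir_deriv_const big1 // => i _; rewrite dir_deriv_const mulr0.
- by rewrite dir_deriv_x entry; apply: eq_bigr => i _; rewrite dir_deriv_x.
- by rewrite dir_deriv_y entry; apply: eq_bigr => i _; rewrite dir_deriv_y.
- by rewrite dir_deriv_z entry; apply: eq_bigr => i _; rewrite dir_deriv_z.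
- rewrite dir_derivD ep eq -big_split; apply: eq_bigr => i _.
  by rewrite dir_derivD mulrDr.
- rewrite dir_derivM ep eq !mulr_sumr -big_split; apply: eq_bigr => i _ /=.
  by rewrite dir_derivM; ring.
Qed.

Definition gradient : 'cV[k]_3 := \col_i dir_deriv (delta_mx 0 i) (eqB a b).

Lemma gradientE (v : 'rV[k]_3) : v *m gradient = (dir_deriv v (eqB a b))%:M.
Proof.
apply/matrixP=> i j; rewrite !ord1 !mxE eqxx mulr1n [in RHS](row_sum_delta v).
by rewrite dir_deriv_sum; apply: eq_bigr => l _; rewrite !mxE.
Qed.

Lemma gradient_orth (v : 'rV[k]_3) : v *m gradient = 0 <-> dir_deriv v (eqB a b) = 0.
Proof.
rewrite gradientE; split=> [/matrixP/(_ 0 0)|->]; last exact: raddf0.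
by rewrite !mxE eqxx mulr1n.
Qed.

Lemma dir_deriv_polyC (v : 'rV[k]_3) (f : A) : v 0 ix = 0 -> v 0 iy = 0 -> dir_deriv v f%:P = 0.
Proof.
move=> vx vy; elim/poly2_closed_ind: f => [c|||p q ep eq|p q ep eq].
- exact: dir_deriv_const.
- by rewrite dir_deriv_x.
- by rewrite dir_deriv_y.
- by rewrite polyCD dir_derivD ep eq addr0.
- by rewrite polyCM dir_derivM ep eq !mulr0 addr0.
Qed.

(* If the gradient of [a z - b] vanished, [a] and [b] would vanish and have *)
(* proportional gradients at the point, while generating its maximal ideal. *)
Lemma gradient_neq0 : gradient != 0.
Proof.
apply/eqP => G0.
have eq0 (v : 'rV[k]_3) : pt a%:P * v 0 iz + pt 'X * dir_deriv v a%:P - dir_deriv v b%:P = 0.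
  rewrite -dir_deriv_z -dir_derivM -dir_derivB; apply/gradient_orth.
  by rewrite G0 mulmx0.
have pta : pt a%:P = 0.
  have := eq0 (delta_mx 0 iz); rewrite !dir_deriv_polyC ?mxE //=.
  by rewrite mulr1 mulr0 addr0 subr0.
have ptb : pt b%:P = 0.
  have : pt (eqB a b + b%:P) = pt b%:P by rewrite rmorphD /= presB_eqB ?add0r.
  by rewrite subrK rmorphM thetaM pta mul0r.
have db v : dir_deriv v b%:P = pt 'X * dir_deriv v a%:P.
  by have /eqP := eq0 v; rewrite pta mul0r add0r subr_eq0 => /eqP.
have dE f : phi f = 0 -> exists s, forall v, dir_deriv v f%:P = s * dir_deriv v a%:P.
  move=> /phi_ker[p [q ->]]; exists (pt p%:P + pt q%:P * pt 'X) => v.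
  by rewrite polyCD !polyCM dir_derivD !dir_derivM db pta ptb; ring.
have [|s es] := dE ('X - (phi 'X%:P)%:P)%:P.
  by rewrite polyCB rmorphB /= phi_const subrr.
have [|t et] := dE ('X - (phi 'X)%:P%:P); first by rewrite rmorphB /= phi_const subrr.
have esx (v : 'rV[k]_3) : v 0 ix = s * dir_deriv v a%:P.
  by rewrite -es !polyCB dir_derivB dir_deriv_const subr0 dir_deriv_x.
have ety (v : 'rV[k]_3) : v 0 iy = t * dir_deriv v a%:P.
  by rewrite -et polyCB dir_derivB dir_deriv_const subr0 dir_deriv_y.
(* The gradients of [x - x0] and [y - y0] would both be multiples of the gradient of [a], yet they
   are independent. *)
have e1 := esx (delta_mx 0 ix); have e2 := ety (delta_mx 0 ix).
have e3 := ety (delta_mx 0 iy).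
rewrite !mxE /= in e1 e2 e3.
have t0 : t = 0.
  rewrite -[t]mulr1 [X in t * X](e1 : 1 = _) mulrCA -e2; exact: mulr0.
by move/eqP: e3; rewrite t0 mul0r oner_eq0.
Qed.

(** Computed on an arbitrary lift to [A[z]]; for [v] orthogonal to the gradient the lift does not
    matter ([tangent_derivE]). *)
Definition tangent_deriv (v : 'rV[k]_3) (f : B) : k :=
  dir_deriv v (projT1 (cid (presB_surj f))).

Lemma tangent_derivE v P : v *m gradient = 0 -> tangent_deriv v (pB P) = dir_deriv v P.
Proof.
move=> /gradient_orth v0; rewrite /tangent_deriv; case: cid => Q /= e.
apply/eqP; rewrite -subr_eq0 -dir_derivB.
have [|R ->] := @presB_eq0 _ _ _ a_prime nab (Q - P).
  by rewrite presBB e subrr.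
by rewrite dir_derivM v0 presB_eqB // theta0 mulr0 mul0r addr0.
Qed.

Lemma tangent_deriv_point v :
  v *m gradient = 0 -> point_derivation cB theta (tangent_deriv v).
Proof.
move=> v0; split=> [f g|c f|f g].
- have [P ->] := presB_surj f; have [Q ->] := presB_surj g.
  by rewrite -rmorphD !tangent_derivE // dir_derivD.
- have [P ->] := presB_surj f.
  rewrite -presB_const -rmorphM !tangent_derivE // dir_derivM dir_deriv_const.
  by rewrite presB_const theta_const mulr0 addr0.
- have [P ->] := presB_surj f; have [Q ->] := presB_surj g.
  by rewrite -rmorphM !tangent_derivE // dir_derivM.
Qed.

(** The values of [D] on the three generators form [v]; orthogonality to the gradient says that [D]
    kills [az - b]. *)
Lemma point_derivation_dir D : point_derivation cB theta D ->
  exists v : 'rV[k]_3, v *m gradient = 0 /\ forall P, D (pB P) = dir_deriv v P.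
Proof.
move=> [DD DZ DM].
have theta1 : theta 1 = 1 by case: theta_point.
have D1 : D 1 = 0.
  by apply: (addrI (D 1)); rewrite addr0 -{3}[1]mulr1 DM theta1 !mul1r.
exists (\row_j [:: D (pB 'X%:P%:P); D (pB 'X%:P); D (pB 'X)]`_j).
set v := (X in X *m _).
have DE P : D (pB P) = dir_deriv v P.
  elim/poly3_closed_ind: P => [c||||p q ep eq|p q ep eq].
  - by rewrite dir_deriv_const presB_const -[cB c]mulr1 DZ D1 mulr0.
  - by rewrite dir_deriv_x mxE.
  - by rewrite dir_deriv_y mxE.
  - by rewrite dir_deriv_z mxE.
  - by rewrite rmorphD DD ep eq dir_derivD.
  - by rewrite rmorphM DM ep eq dir_derivM.
split=> //; apply/gradient_orth; rewrite -DE presB_eqB //.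
by apply: (addrI (D 0)); rewrite -DD !addr0.
Qed.

Lemma B_tangent_dim : tangent_dim_eq cB theta 2.
Proof.
have [W [freeW WG spanW]] := row_kernel_basis gradient_neq0.
have rowG i : row i W *m gradient = 0 by rewrite -row_mul WG row0.
have sumE (c : 'rV_2) P :
    \sum_i c 0 i * tangent_deriv (row i W) (pB P) = dir_deriv (c *m W) P.
  rewrite mulmx_sum_row dir_deriv_sum; apply: eq_bigr => i _.
  by rewrite tangent_derivE.
exists (fun i => tangent_deriv (row i W)); split.
- by move=> i; apply: tangent_deriv_point.
- move=> D /point_derivation_dir[v [/spanW[c ->] DE]].
  exists (c 0) => f; have [P ->] := presB_surj f.
  by rewrite DE -sumE.
- move=> c c0 i; pose r : 'rV_2 := \row_j c j.
  have r0 P : dir_deriv (r *m W) P = 0.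
    by rewrite -sumE -[RHS](c0 (pB P)); apply: eq_bigr => j _; rewrite mxE.
  (* The derivatives of the three coordinates recover the direction vector. *)
  have rW : r *m W = 0.
    apply/rowP=> -[[|[|[|//]]] lj]; rewrite [RHS]mxE.
    + by rewrite -[RHS](r0 'X%:P%:P) dir_deriv_x; congr (fun_of_matrix _ _ _); apply: val_inj.
    + by rewrite -[RHS](r0 'X%:P) dir_deriv_y; congr (fun_of_matrix _ _ _); apply: val_inj.
    + by rewrite -[RHS](r0 'X) dir_deriv_z; congr (fun_of_matrix _ _ _); apply: val_inj.
  have /rowP/(_ i) : r = 0 by apply: (row_free_inj freeW); rewrite rW mul0mx.
  by rewrite !mxE.
Qed.

End TangentSpace.

(** * The quotient of the plane by [a] *)

Section LaurentQuotient.
Variables (k : fieldType) (a : poly2 k) (phi : {rmorphism poly2 k -> {fraction {poly k}}}).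
Hypothesis phi_const : forall c : k, phi c%:P%:P = (c%:P)%:F.
Hypothesis phi_ker : forall x, phi x = 0 <-> exists q, x = a * q.
Hypothesis phi_im : forall z, (exists x, phi x = z) <->
  exists (p : {poly k}) (n : nat), z = p%:F / (('X^n)%:F).

Lemma phi_X_ex : exists x, phi x = 'X%:F.
Proof. by apply/phi_im; exists 'X, 0%N; rewrite expr0 tofrac1 divr1. Qed.

Lemma tofracX_const (c : k) : 'X%:F <> (c%:P)%:F.
Proof.
move/eqP; rewrite tofrac_eq => /eqP/(congr1 (fun p : {poly k} => size p)).
by rewrite size_polyX size_polyC; case: (c != 0).
Qed.

(** The kernel of a map to a field is prime. If [a] were zero, [phi] would be injective and a
    preimage of [t] would be a unit of [k[x,y]], hence a constant. *)
Lemma laurent_quotient_prime : prime_elt a.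
Proof.
split.
- have [x ex] := phi_X_ex.
  have [|y ey] := (phi_im ('X%:F)^-1).2.
    by exists 1, 1%N; rewrite expr1 tofrac1 mul1r.
  apply/eqP => a0; have xy1 : x * y = 1.
    apply/eqP; rewrite -subr_eq0; apply/eqP.
    have /phi_ker[q ->] : phi (x * y - 1) = 0; last by rewrite a0 mul0r.
    by rewrite rmorphB rmorphM rmorph1 /= ex ey divff ?subrr // tofrac_eq0 polyX_eq0.
  have [|p [Up ep]] := @is_unit_polyC _ x; first by exists y.
  have [c [_ ec]] := is_unit_polyC Up.
  by apply: (@tofracX_const c); rewrite -ex ep ec phi_const.
- move=> [z /esym/(ex_intro _ z)/phi_ker/eqP]; apply/negP.
  by rewrite rmorph1 oner_neq0.
- move=> x y [z exy]; have /eqP : phi (x * y) = 0.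
    by apply/phi_ker; exists z; rewrite exy mulrC.
  have dv f : phi f = 0 -> divides a f.
    by move/phi_ker=> [q ->]; exists q; rewrite mulrC.
  by rewrite rmorphM mulf_eq0 => /orP[]/eqP/dv; [left | right].
Qed.

(** If [a] divided [b], then [(a, b) = (a)], and a preimage of [t] would be congruent to a constant
    modulo [a]. *)
Lemma laurent_quotient_ndivides (b : poly2 k) (psi : {rmorphism poly2 k -> k}) :
  (forall c : k, psi c%:P%:P = c) ->
  (forall x, psi x = 0 -> exists p q, x = a * p + b * q) -> ~ divides a b.
Proof.
move=> psi_const psi_ker [z eb]; have [x ex] := phi_X_ex.
have [|p [q e]] := psi_ker (x - (psi x)%:P%:P).
  by rewrite rmorphB /= psi_const subrr.
apply: (@tofracX_const (psi x)); apply/eqP; rewrite -subr_eq0 -phi_const -ex -rmorphB.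
by apply/eqP/phi_ker; exists (p + z * q); rewrite e eb; ring.
Qed.

End LaurentQuotient.

Theorem theorem3p1 (k : fieldType) (a b : poly2 k)
  (* A/aA ~= k[t,t^-1] as k-algebras: a surjection of k-algebras onto the *)
  (* Laurent polynomials {p / t^n} inside k(t), with kernel aA.           *)
  (Ha : exists phi : {rmorphism poly2 k -> {fraction {poly k}}},
     [/\ forall c : k, phi (c%:P%:P) = (c%:P)%:F,
         forall x, phi x = 0 <-> exists q, x = a * q
       & forall z, (exists x, phi x = z) <->
           exists (p : {poly k}) (n : nat), z = p%:F / (('X^n)%:F)])
  (* A/bA ~= k[t] as k-algebras. *)
  (Hb : exists phi : {rmorphism poly2 k -> {poly k}},
     [/\ forall c : k, phi (c%:P%:P) = c%:P,
         forall x, phi x = 0 <-> exists q, x = b * q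
       & forall z, exists x, phi x = z])
  (* A/(aA + bA) ~= k as k-algebras. *)
  (Hab : exists phi : {rmorphism poly2 k -> k},
     [/\ forall c : k, phi (c%:P%:P) = c,
         forall x, phi x = 0 <-> exists p q, x = a * p + b * q
       & forall z, exists x, phi x = z]) :
  (* (a) B = A[b/a] is a UFD and B^* = k^*. *)
  (UFD (Bring a b) /\
   forall u : Bring a b, is_unit u <-> exists c : k, c != 0 /\ u = constB a b c)
  /\
  (* (b) over an algebraically closed k, X = Spec B is a smooth affine      *)
  (* factorial surface over k with O(X)^* = k^*.                            *)
  (GRing.closed_field_axiom k ->
     [/\ smooth_affine_surface (constB a b), UFD (Bring a b)
       & forall u : Bring a b, is_unit u <-> exists c : k, c != 0 /\ u = constB a b c]).
Proof.
have [phi [phi_const phi_ker phi_im]] := Ha.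
have [psi [psi_const psi_ker _]] := Hab.
have a_prime := laurent_quotient_prime phi_const phi_ker phi_im.
have nab : ~ divides a b.
  apply: (laurent_quotient_ndivides phi_const phi_ker phi_im psi_const) => x.
  by move/psi_ker.
have ufd : UFD (Bring a b).
  apply: (factorial_UFD (@B_domain k a b)).
  exact: (B_factorial a_prime nab psi_const psi_ker).
have units := B_units a_prime nab psi_ker.
split=> // _; split=> //; split.
- exact: B_finite_type.
- exact: (B_krull_dim a_prime nab psi_ker).
- by move=> theta; apply: (B_tangent_dim a_prime nab psi_const psi_ker).
Qed.
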